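(* Let $k\ge3$, $m\ge1$, $W=I_2(k)$, and let $\Gamma^{(m)}$ be its $m$-cluster complex, with $C_{mk+2}$ acting on faces through the Fomin–Reading rotation $\mathcal{R}_m$. Let $W_X$ be a parabolic subgroup of $W$, let $\Gamma^{(m)}_X$ be the set of faces of parabolic type (conjugacy class of) $W_X$, and let \[ \mu_X(q)=\begin{cases}1 & \text{if } W_X=W,\\ \frac{[mk+2]_q}{[2]_q} & \text{if } k \text{ is even and } \mathrm{rk}(W_X)=1,\\ [mk+2]_q & \text{if } k \text{ is odd and } \mathrm{rk}(W_X)=1,\\ \frac{[mk+2]_q[(m+1)k]_q}{[2]_q[k]_q} & \text{if } W_X \text{ is trivial}.\end{cases} \] Then $(\Gamma^{(m)}_X, C_{mk+2},\mu_X(q))$ exhibits the cyclic sieving phenomenon.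
   Context: $[a]_q=1+q+\dots+q^{a-1}$. CSP: $(S,C,P)$ exhibits the cyclic sieving phenomenon if for every $g\in C$ of order $d$, $P(e^{2i\pi/d})$ equals the number of elements of $S$ fixed by $g$. $W=I_2(k)$ is the dihedral group of order $2k$ with root system $\Phi$, simple roots $\alpha_1,\alpha_2$, simple reflections $s_1,s_2$, $c_+=s_1$, $c_-=s_2$, $c=c_+c_-$. Almost positive roots: $\Phi_{\ge-1}=\Phi_+\cup\{-\alpha_1,-\alpha_2\}$. Fomin–Zelevinsky rotation: $\tau_+(\alpha)=\alpha$ if $\alpha=-\alpha_2$, else $c_+(\alpha)$; $\tau_-(\alpha)=\alpha$ if $\alpha=-\alpha_1$, else $c_-(\alpha)$; $\mathcal{R}=\tau_-\tau_+$. $m$-colored almost positive roots: $\Phi^{(m)}_{\ge-1}=\{\alpha^i:\alpha\in\Phi_+,1\le i\le m\}\cup\{(-\alpha_1)^1,(-\alpha_2)^1\}$. Fomin–Reading rotation: $\mathcal{R}_m(\alpha^i)=\alpha^{i+1}$ if $\alpha\in\Phi_+$ and $i<m$, and $(\mathcal{R}(\alpha))^1$ otherwise; its order divides $mk+2$, and a generator of $C_{mk+2}$ acts by $\mathcal{R}_m$. Compatibility: the unique symmetric relation with $(-\alpha_j)^1\|\beta^i$ iff $\alpha_j$ has coefficient $0$ in $\beta$, invariant under $\mathcal{R}_m$. $\Gamma^{(m)}$ is the simplicial complex of pairwise compatible sets. Parabolic type of a face $f=\{\beta_1^{i_1},\dots,\beta_r^{i_r}\}$: order it so that $t_{\beta_1}\cdots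 t_{\beta_r}$ lies in the absolute-order interval $[e,c]$, put $\underline f=c_+t_{\beta_1}\cdots t_{\beta_r}c_-$, and take the conjugacy class of the pointwise stabilizer of $\mathrm{Fix}(\underline f)$. *)

(* Defs.v *)
From HB Require Import structures.
From mathcomp Require Import all_boot all_order all_algebra all_fingroup all_solvable.
From mathcomp Require Import finmap.
From mathcomp Require Import boolp classical_sets reals topology normedtype trigo.
From mathcomp Require Import complex.
From mathcomp Require Import ring.

Set Implicit Arguments.
Unset Strict Implicit.
Unset Printing Implicit Defensive.

Import Order.TTheory GRing.Theory Num.Theory.
Local Open Scope ring_scope.
Local Open Scope complex_scope.

(** * Cyclic sieving *)

Definition expi {R : realType} (t : R) : R[i] := (cos t +i* sin t)%C.

(* The first four clauses say that [act] is an action of the cyclic group [C]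
   on the finite set [S]. *)
Definition cyclic_sieving (R : realType) (T : choiceType) (gT : finGroupType)
    (S : {fset T}) (C : {group gT}) (act : gT -> T -> T) (P : {poly int}) :
    Prop :=
  [/\ cyclic C,
      (forall g x, g \in C -> x \in S -> act g x \in S),
      (forall x, x \in S -> act 1%g x = x),
      (forall g h x, g \in C -> h \in C -> x \in S ->
         act (g * h)%g x = act g (act h x)) &
      forall g, g \in C ->
        (map_poly intr P).[expi (2 * pi / #[g]%g%:R : R)]
        = #|` [fset x in S | act g x == x]%fset |%:R :> R[i] ].

Definition qint (a : nat) : {poly int} := \sum_(i < a) 'X^i.

Lemma qintM a b : qint (a * b) = qint a * \sum_(i < b) 'X^(a * i).
Proof.
elim: b => [|b IH]; first by rewrite muln0 /qint !big_ord0 mulr0.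
rewrite big_ord_recr /= mulrDr -IH mulnS addnC /qint.
rewrite -!(big_mkord xpredT (fun i => 'X^i)) (big_cat_nat _ (leq_addr a (a * b))) //=.
congr (_ + _); rewrite -{1}[(a * b)%N]add0n big_addn addKn.
rewrite mulr_suml; apply: eq_bigr => i _; by rewrite exprD.
Qed.

Lemma qint_dvd a b : (a %| b)%N -> exists p, qint b = p * qint a.
Proof. by move=> /dvdnP[c ->]; rewrite mulnC qintM; eexists; rewrite mulrC. Qed.

Lemma qint2_dvd_1Xn k : odd k -> exists p, 1 + 'X^k = p * qint 2.
Proof.
move=> ok; rewrite -[k]odd_double_half ok add1n.
have -> : qint 2 = 1 + 'X by rewrite /qint 2!big_ord_recr big_ord0 /= add0r expr0 expr1.
elim: (k./2) => [|n [p IH]]; first by exists 1; rewrite mul1r expr1.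
exists ('X^2 * p + 1 - 'X); rewrite doubleS.
have -> : 1 + 'X^(n.*2.+3) = 'X^2 * (1 + 'X^(n.*2.+1)) + (1 - 'X^2) :> {poly int}.
  by rewrite mulrDr -exprD mulr1 [RHS]addrAC; congr (_ + _); ring.
by rewrite IH; ring.
Qed.

Lemma qint_monic a : qint a.+1 \is monic.
Proof.
have -> : qint a.+1 = \poly_(i < a.+1) 1.
  by rewrite poly_def; apply: eq_bigr => i _; rewrite scale1r.
by rewrite monicE lead_coef_poly // oner_neq0.
Qed.

Lemma mu_rank1_exact k m : ~~ odd k ->
  qint (m * k + 2) %/ qint 2 * qint 2 = qint (m * k + 2).
Proof.
move=> ek; have [p ->] : exists p, qint (m * k + 2) = p * qint 2.
  by apply: qint_dvd; rewrite dvdn2 oddD oddM (negbTE ek) andbF.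
by rewrite Pdiv.IdomainMonic.mulpK ?qint_monic.
Qed.

Lemma mu_trivial_exact k m : (0 < k)%N ->
  (qint (m * k + 2) * qint ((m + 1) * k)) %/ (qint 2 * qint k)
    * (qint 2 * qint k)
  = qint (m * k + 2) * qint ((m + 1) * k).
Proof.
move=> k0; suff [p ->] : exists p,
    qint (m * k + 2) * qint ((m + 1) * k) = p * (qint 2 * qint k).
  rewrite Pdiv.IdomainMonic.mulpK //.
  by rewrite rpredM ?qint_monic // -(prednK k0) qint_monic.
have [omk|emk] := boolP (odd m && odd k).
  case/andP: omk => om ok; have [p Hp] := qint2_dvd_1Xn ok.
  have [|r Hr] := @qint_dvd (k * 2) ((m + 1) * k).
    by rewrite mulnC dvdn_pmul2r // dvdn2 oddD om.
  exists (qint (m * k + 2) * r * p); rewrite Hr qintM 2!big_ord_recr big_ord0 /=.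
  by rewrite add0r muln0 muln1 expr0 Hp; ring.
have [|p Hp] := @qint_dvd 2 (m * k + 2).
  by rewrite dvdn2 oddD oddM (negbTE emk).
have [|r Hr] := @qint_dvd k ((m + 1) * k); first exact: dvdn_mull.
by exists (p * r); rewrite Hp Hr; ring.
Qed.

(** * The dihedral group I_2(k) and its root system *)

Section Dihedral.
Variables (R : realType) (k : nat).

Local Notation V := 'cV[R]_2.

(* The root system of I_2(k): the 2k unit vectors at angles j * pi / k. *)
Definition rootvec (j : nat) : V :=
  \col_(i < 2) (if i == 0 then cos (j%:R * pi / k%:R)
                else sin (j%:R * pi / k%:R)).

Definition roots : {fset V} := [fset rootvec j | j in iota 0 (2 * k)]%fset.

(* The simple roots are at angles 0 and pi - pi / k. *)
Definition simple : 2.-tuple V := [tuple rootvec 0; rootvec k.-1].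
Definition alpha1 : V := tnth simple 0.
Definition alpha2 : V := tnth simple 1.

Definition pos_roots : {fset V} :=
  [fset b in roots | [forall j, 0 <= coord simple j b]]%fset.

Definition refl (b : V) : 'M[R]_2 :=
  1 - (2 / (b^T *m b) 0 0) *: (b *m b^T).

Definition reflprod (s : seq V) : 'M[R]_2 := \prod_(b <- s) refl b.

Definition weyl : set 'M[R]_2 :=
  [set w | exists2 s : seq V, {subset s <= simple} & w = reflprod s].

Definition c_plus : 'M[R]_2 := refl alpha1.
Definition c_minus : 'M[R]_2 := refl alpha2.
Definition cox : 'M[R]_2 := c_plus * c_minus.

(** ** Absolute order *)

Definition is_abs_length (w : 'M[R]_2) (n : nat) : Prop :=
  (exists2 s : seq V, {subset s <= roots} & reflprod s = w /\ size s = n) /\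
  (forall s : seq V, {subset s <= roots} -> reflprod s = w -> (n <= size s)%N).

Definition abs_length (w : 'M[R]_2) : nat := get [set n | is_abs_length w n].

Definition abs_le (u w : 'M[R]_2) : Prop :=
  [/\ weyl u, weyl w &
      abs_length w = (abs_length u + abs_length (u^-1 * w))%N].

(** ** Parabolic subgroups *)

Definition Fix (w : 'M[R]_2) : set V := [set v | w *m v = v].

Definition pstab (A : set V) : set 'M[R]_2 :=
  [set w | weyl w /\ forall v, A v -> w *m v = v].

Definition hyperplane (b : V) : {vspace V} :=
  lker (linfun (mulmx b^T : V -> 'M[R]_1)).

(* The intersection lattice of the reflection arrangement (the empty
   intersection is the whole plane). *)
Definition flat (X : {vspace V}) : Prop :=
  exists2 s : seq V, {subset s <= roots} &
    X = (\bigcap_(b <- s) hyperplane b)%VS.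

Definition parabolic (X : {vspace V}) : set 'M[R]_2 := pstab [set v | v \in X].

(* For a flat X, the rank of [parabolic X]. *)
Definition rk (X : {vspace V}) : nat := (2 - \dim X)%N.

Definition conj_subgroups (P Q : set 'M[R]_2) : Prop :=
  exists2 w, weyl w & Q = [set w * p * w^-1 | p in P]%classic.

(** ** Colored almost positive roots and rotations *)

Definition tau_plus (a : V) : V := if a == - alpha2 then a else c_plus *m a.
Definition tau_minus (a : V) : V := if a == - alpha1 then a else c_minus *m a.
Definition rot (a : V) : V := tau_minus (tau_plus a).

Variable m : nat.

Local Notation croot := (V * nat)%type.

Definition colored_roots : {fset croot} :=
  ([fset ((b, i) : croot) | b in pos_roots, i in iota 1 m]
   `|` [fset ((- alpha1, 1%N) : croot); ((- alpha2, 1%N) : croot)])%fset.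

Definition crot (x : croot) : croot :=
  if (x.1 \in pos_roots) && (x.2 < m)%N then (x.1, x.2.+1) else (rot x.1, 1%N).

(* The first clause makes [r] a relation on the colored roots only, so that
   the uniqueness of the compatibility relation makes sense. *)
Definition is_compatibility (r : rel croot) : Prop :=
  [/\ (forall x y, r x y -> x \in colored_roots /\ y \in colored_roots),
      (forall x y, r x y = r y x),
      (forall (j : 'I_2) (y : croot), y \in colored_roots ->
         r (- tnth simple j, 1%N) y = (coord simple j y.1 == 0)) &
      (forall x y, x \in colored_roots -> y \in colored_roots ->
         r (crot x) (crot y) = r x y)].

Definition compatible : rel croot := get [set r : croot -> croot -> bool | is_compatibility r].

(** ** The m-cluster complex *)

Definition cluster_complex : {fset {fset croot}} :=
  [fset f in fpowerset colored_roots |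
     [forall x : f, forall y : f,
        (x != y) ==> compatible (fsval x) (fsval y)]]%fset.

Definition rotate_face (f : {fset croot}) : {fset croot} :=
  [fset crot x | x in f]%fset.

Definition has_parabolic_type (f : {fset croot}) (P : set 'M[R]_2) : Prop :=
  exists s : seq croot,
    [/\ perm_eq s f,
        abs_le (reflprod (unzip1 s)) cox &
        conj_subgroups (pstab (Fix (c_plus * reflprod (unzip1 s) * c_minus))) P].

Definition faces_of_type (P : set 'M[R]_2) : {fset {fset croot}} :=
  [fset f in cluster_complex | `[< has_parabolic_type f P >]]%fset.

(* The remaining case of the last [else] is that of a trivial [parabolic X].
   The divisions are exact, see [mu_rank1_exact] and [mu_trivial_exact]. *)
Definition mu (X : {vspace V}) : {poly int} :=
  if `[< parabolic X = weyl >] then 1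
  else if rk X == 1%N then
    if ~~ odd k then qint (m * k + 2) %/ qint 2 else qint (m * k + 2)
  else (qint (m * k + 2) * qint ((m + 1) * k)) %/ (qint 2 * qint k).

End Dihedral.

(* Main.v *)
Require Import Defs.
From mathcomp Require Import all_boot all_order all_algebra all_fingroup.
From mathcomp Require Import finmap boolp classical_sets reals.
From mathcomp Require Import cyclic trigo complex zify ring lra.

Set Implicit Arguments.
Unset Strict Implicit.
Unset Printing Implicit Defensive.

Import Order.TTheory GRing.Theory Num.Theory.

(** Let [rho_j] be the root at angle [j pi / k] and [N = m k + 2]. The
    Fomin-Zelevinsky rotation is [j |-> j - 2] on the indices modulo [k + 2] of
    the almost positive roots [rho_{-1} = - alpha_2, rho_0, ..., rho_k = - alpha_1],
    so the Fomin-Reading rotation is a single [N]-cycle when [k] is odd, and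
    consists of two cycles of length [N / 2], told apart by the parity of [j],
    when [k] is even. Compatibility is the symmetric closure of an explicit
    relation [x -> y] along which the root index grows by one modulo [k];
    it has no triangle, every vertex has [m + 1] neighbours, and [t_y t_x = c]
    when [x -> y]. Hence the empty face has type [W], the vertex [rho_j^i] has
    the type of the reflection [c_+ t_{rho_j} c_- = t_{rho_{-j-1}}], and the edges
    have trivial type. An edge fixed by a rotation of order [d] forces [d | 2]:
    for [d = 2] and [k] even all edges are fixed, while for [d = 2] and [k] odd
    the fixed edges are the [N / 2] pairs of opposite vertices. On the other side, a
    primitive [d]-th root of unity with [d | N] can only cancel a factor of the
    denominators when [d | 2], since [d | k] and [d | N] imply [d | 2]. *)

(** * The rotation on the colored roots *)

(** The list [codom g] has [#|U|] entries and meets every point of [U], so it has no repetition.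
    This turns reachability of all vertices into exactness of periods. *)
Lemma surj_inj_card (S U : finType) (g : S -> U) :
  #|S| = #|U| -> (forall y, exists x, y = g x) -> injective g.
Proof.
move=> cSU sg; apply/injectiveP; rewrite /injectiveb /dinjectiveb.
rewrite -/(codom g); apply/card_uniqP; rewrite size_codom cSU.
by apply: eq_card => y; case: (sg y) => x ->; rewrite codom_f.
Qed.

Section Combinatorics.
Local Open Scope nat_scope.
Variables (k m : nat).
Hypotheses (hk : 2 < k) (hm : 0 < m).

Local Notation N := (m * k + 2).

(* For [j < k] the code [(j, i)] stands for the root at angle [j pi / k] with
   color [i]; [(k, 1)] and [(k.+1, 1)] stand for [- alpha_1] and [- alpha_2]. *)
Definition code_valid (x : nat * nat) : bool :=
  (x.1 < k) && (0 < x.2 <= m) || (k <= x.1 <= k.+1) && (x.2 == 1).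

(** Indices live modulo [k + 2], with [k.+1] in the role of -1; hence [j - 2] becomes [j + k] for
    [j] at most 1. *)
Definition code_rot (x : nat * nat) : nat * nat :=
  if (x.1 < k) && (x.2 < m) then (x.1, x.2.+1)
  else (if 1 < x.1 then x.1 - 2 else x.1 + k, 1).

(** The two middle clauses encode the vanishing coefficients that prescribe compatibility with a
    negative simple root; the outer two are what rotation makes of them between positive roots. The
    orientation is the one with t_y t_x = c. *)
Definition code_arrow (x y : nat * nat) : bool :=
  [|| [&& y.1 == x.1.+1, y.1 < k & x.2 <= y.2],
      (x.1 == k.+1) && ((y.1 == 0) || (y.1 == k)),
      (x.1 == k.-1) && (y.1 == k) |
      [&& x.1 == k.-1, y.1 == 0 & x.2 < y.2] ].

Definition code_adj x y := code_arrow x y || code_arrow y x.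

Lemma code_rot_valid x : code_valid x -> code_valid (code_rot x).
Proof.
case: x => j i; rewrite /code_valid /code_rot /=.
by case: ifP => /= h1; last case: ifP => /= h2; lia.
Qed.

Ltac choose_arrow :=
  first [apply: Or41; lia | apply: Or42; lia | apply: Or43; lia
        | apply: Or44; lia].

(** Only adjacency survives: between consecutive indices below [k], if the target alone has color
    [m], it drops by two indices, lands just below the source, and the arrow turns round. *)
Lemma code_arrow_rot x y : code_valid x -> code_valid y ->
  code_arrow x y -> code_adj (code_rot x) (code_rot y).
Proof.
case: x y => [j i] [j' i'] Vx Vy /or4P C; apply/orP.
move: Vx Vy C; rewrite /code_valid /code_rot /code_arrow /= => /orP[] Vx /orP[] Vy.
all: case=> C.
all: case: ifP => /= h1; last case: ifP => /= h2.
all: case: ifP => /= h3; last case: ifP => /= h4.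
all: first [exfalso; lia | left; apply/or4P => /=; choose_arrow | right; apply/or4P => /=; choose_arrow].
Qed.

Lemma code_adj_rot x y : code_valid x -> code_valid y ->
  code_adj x y -> code_adj (code_rot x) (code_rot y).
Proof.
move=> Vx Vy /orP[]; first exact: code_arrow_rot.
by rewrite /code_adj orbC; apply: code_arrow_rot.
Qed.

Lemma code_arrow_asym x y : code_valid x -> code_valid y ->
  code_arrow x y -> ~~ code_arrow y x.
Proof.
case: x y => [j i] [j' i'] Vx Vy /or4P C; apply/negP => /or4P D.
by move: Vx Vy C D; rewrite /code_valid /= => /orP[] Vx /orP[] Vy [] C [] D; lia.
Qed.

Lemma code_adj_irrefl x : code_valid x -> ~~ code_adj x x.
Proof.
move=> Vx; rewrite /code_adj orbb; apply/negP => H.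
by have := code_arrow_asym Vx Vx H; rewrite H.
Qed.

(* Along an arrow between positive roots the index grows by one modulo [k] and
   the color weakly, strictly from [k-1] to [0]: so no 3-cycle even if [k = 3]. *)
Lemma code_arrow_triangle x y z : code_valid x -> code_valid y -> code_valid z ->
  code_arrow x y -> code_arrow y z -> ~~ code_adj x z.
Proof.
case: x y z => [j i] [j' i'] [j'' i''] Vx Vy Vz /or4P C /or4P D.
apply/negP => /orP[] /or4P E; move: Vx Vy Vz C D E; rewrite /code_valid /=.
all: move=> /orP[] Vx /orP[] Vy /orP[] Vz.
all: by case=> C; (try lia); case=> D; (try lia); case=> E; lia.
Qed.

(** Both targets lie one index above the source modulo [k], so they agree modulo [k], whereas an
    arrow would make them differ by one. *)
Lemma code_arrow_fork x y z : code_valid x -> code_valid y -> code_valid z ->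
  code_arrow x y -> code_arrow x z -> ~~ code_arrow y z.
Proof.
case: x y z => [j i] [j' i'] [j'' i''] Vx Vy Vz /or4P C /or4P D.
apply/negP => /or4P E; move: Vx Vy Vz C D E; rewrite /code_valid /=.
all: move=> /orP[] Vx /orP[] Vy /orP[] Vz.
all: by case=> C; (try lia); case=> D; (try lia); case=> E; lia.
Qed.

(** Two edges form a directed path, share a source or share a target; in the last case the third
    edge creates a common source. *)
Lemma code_adj_triangle x y z : code_valid x -> code_valid y -> code_valid z ->
  code_adj x y -> code_adj y z -> ~~ code_adj x z.
Proof.
move=> Vx Vy Vz /orP[] C /orP[] D.
- exact: (code_arrow_triangle Vx Vy Vz).
- apply/negP => /orP[] E; first by have := code_arrow_fork Vx Vz Vy E C; rewrite D.
  by have := code_arrow_fork Vz Vx Vy E D; rewrite C.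
- rewrite /code_adj negb_or (code_arrow_fork Vy Vx Vz) //.
  by rewrite (code_arrow_fork Vy Vz Vx).
- by rewrite /code_adj orbC; apply: (code_arrow_triangle Vz Vy Vx).
Qed.

(** A finite type makes orbits and edges countable, while the arithmetic is done on codes. Ordinal
    colors start at 0 and code colors at 1, whence the shift in [code]. *)
Definition vertex : finType := ('I_k * 'I_m + bool)%type.

Definition code (x : vertex) : nat * nat :=
  match x with
  | inl (j, i) => (val j, (val i).+1)
  | inr b => (if b then k else k.+1, 1)
  end.

Definition decode (x : nat * nat) : vertex :=
  match insub x.1, insub x.2.-1 with
  | Some j, Some i => inl (j, i)
  | _, _ => inr (x.1 == k)
  end.

Lemma code_validP x : code_valid (code x).
Proof. by rewrite /code_valid; case: x => [[j i]|[]] /=; [have := ltn_ord j; have := ltn_ord i|..]; lia. Qed.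

Lemma codeK : cancel code decode.
Proof.
case=> [[j i]|[]]; rewrite /decode /= ?valK // insubF ?eqxx ?ltnn ?ltnNge ?leqnSn //.
by rewrite gtn_eqF.
Qed.

Lemma code_inj : injective code. Proof. exact: can_inj codeK. Qed.

Lemma decodeK x : code_valid x -> code (decode x) = x.
Proof.
case: x => j i; rewrite /code_valid /decode /= => /orP[/andP[jk /andP[i0 im]]|].
  have im' : i.-1 < m by rewrite prednK.
  by rewrite !insubT /= prednK.
move=> /andP[/andP[kj jk] /eqP->]; rewrite insubF /=; last by rewrite ltnNge kj.
by case: eqP => [->//|jk']; congr (_, _); lia.
Qed.

Definition vrot (x : vertex) : vertex := decode (code_rot (code x)).
Definition arrow (x y : vertex) := code_arrow (code x) (code y).
Definition adj (x y : vertex) := code_adj (code x) (code y).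

Lemma code_vrot x : code (vrot x) = code_rot (code x).
Proof. by rewrite decodeK // code_rot_valid // code_validP. Qed.

Lemma code_iter_vrot n x : code (iter n vrot x) = iter n code_rot (code x).
Proof. by elim: n => //= n IH; rewrite code_vrot IH. Qed.

(** * Orbits and exact period of the rotation *)

Lemma iter_code_rot_color j i : j < k -> i < m ->
  iter i code_rot (j, 1) = (j, i.+1).
Proof.
move=> jk; elim: i => // i IH im; rewrite iterS IH; last exact: ltnW.
by rewrite /code_rot /= jk im.
Qed.

Lemma iter_code_rot_root j : j < k ->
  iter m code_rot (j, 1) = (if 1 < j then j - 2 else j + k, 1).
Proof.
move=> jk; rewrite -[m in iter m](prednK hm) iterS iter_code_rot_color ?prednK //.
by rewrite /code_rot /= ltnn andbF.
Qed.

Lemma iter_code_rot_roots n j : n.*2 <= j -> j < k ->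
  iter (m * n) code_rot (j, 1) = (j - n.*2, 1).
Proof.
elim: n j => [|n IH] j nj jk; first by rewrite muln0 subn0.
rewrite mulnS iterD IH ?iter_code_rot_root; [|lia..].
by case: ifP => h; congr (_, _); lia.
Qed.

Lemma code_rot_neg1 : code_rot (k, 1) = (k - 2, 1).
Proof. by rewrite /code_rot /= ltnn ifT //; lia. Qed.

Lemma code_rot_neg2 : code_rot (k.+1, 1) = (k.-1, 1).
Proof. by rewrite /code_rot /= ltnNge leqnSn /= ifT; [congr (_, _); lia|lia]. Qed.

(* From [(k, 1)] (resp. [(k.+1, 1)]) the rotation runs through the roots of
   index [k-2, k-4, ...] (resp. [k-1, k-3, ...]), each with colors [1..m]. *)
Lemma iter_code_rot_neg1 n i : n.*2 <= k - 2 -> i < m ->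
  iter (i + (m * n).+1) code_rot (k, 1) = (k - 2 - n.*2, i.+1).
Proof.
move=> nk im; rewrite iterD iterSr code_rot_neg1 iter_code_rot_roots; [|lia..].
by rewrite iter_code_rot_color //; lia.
Qed.

Lemma iter_code_rot_neg2 n i : n.*2 <= k.-1 -> i < m ->
  iter (i + (m * n).+1) code_rot (k.+1, 1) = (k.-1 - n.*2, i.+1).
Proof.
move=> nk im; rewrite iterD iterSr code_rot_neg2 iter_code_rot_roots; [|lia..].
by rewrite iter_code_rot_color //; lia.
Qed.

(** One step leads to index [k - 2]; then [k./2] indices are visited with [m] colors each. The last
    index is 0 for even [k], which returns to - alpha_1, and 1 for odd [k], which leads to -
    alpha_2. *)
Lemma iter_code_rot_neg1_end : iter (m * k./2).+1 code_rot (k, 1) = (k + odd k, 1).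
Proof.
have -> : (m * k./2).+1 = m + (m * (k./2).-1).+1 by nia.
rewrite iterD iterSr code_rot_neg1 iter_code_rot_roots; [|lia..].
by rewrite iter_code_rot_root; [|lia]; rewrite ifF; [congr (_, _)|]; lia.
Qed.

Lemma iter_code_rot_neg2_end :
  iter (m * uphalf k).+1 code_rot (k.+1, 1) = (k + ~~ odd k, 1).
Proof.
have -> : (m * uphalf k).+1 = m + (m * (uphalf k).-1).+1.
  by rewrite addnS -mulnS prednK // uphalf_half; lia.
rewrite iterD iterSr code_rot_neg2 iter_code_rot_roots; [|lia..].
rewrite iter_code_rot_root; [|lia].
by rewrite ifF; [congr (_, _)|]; lia.
Qed.

Definition neg1 : vertex := inr true.
Definition neg2 : vertex := inr false.

(** Indices drop by two along the orbit of a negative simple root, so the parity of the index tells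
    which of the two leads to [x]. *)
Lemma vertex_reach x :
  exists n, x = iter n vrot (if odd (code x).1 == odd k then neg1 else neg2).
Proof.
have Vx := code_validP x; case Ex: (code x) Vx => [j i] /=.
rewrite /code_valid /= => Vx; have [jk|kj] := ltnP j k; last first.
  exists 0; apply: code_inj; rewrite Ex.
  by case: eqP => /= jk; congr (_, _); lia.
case: eqP => jk'.
  exists (i.-1 + (m * ((k - 2 - j)./2)).+1); apply: code_inj.
  by rewrite code_iter_vrot iter_code_rot_neg1 ?Ex; [congr (_, _)|..]; lia.
exists (i.-1 + (m * ((k.-1 - j)./2)).+1); apply: code_inj.
by rewrite code_iter_vrot iter_code_rot_neg2 ?Ex; [congr (_, _)|..]; lia.
Qed.

Definition vperiod := if odd k then N else N./2.

Lemma vperiod_gt0 : 0 < vperiod.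
Proof. by rewrite /vperiod; case: ifP; lia. Qed.

Lemma N_even : ~~ odd k -> N = vperiod.*2.
Proof.
by rewrite /vperiod => /[dup] ek /negbTE->; rewrite -[LHS]odd_double_half oddD oddM (negbTE ek) andbF.
Qed.

(** For odd [k] the arcs from - alpha_1 to - alpha_2 and back have total length [N]; for even [k]
    each arc is already closed and has length [N / 2]. *)
Lemma iter_vperiod_neg b : iter vperiod vrot (inr b) = inr b.
Proof.
apply: code_inj; rewrite code_iter_vrot /vperiod; have [ok|ek] := boolP (odd k).
  have E1 := iter_code_rot_neg1_end; have E2 := iter_code_rot_neg2_end.
  have EN : N = (m * uphalf k).+1 + (m * k./2).+1.
    by rewrite uphalf_half ok; have := odd_double_half k; nia.
  case: b => /=; first by rewrite EN iterD E1 ok addn1 E2 ok addn0.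
  by rewrite EN addnC iterD E2 ok addn0 E1 ok addn1.
have EN : N./2 = (m * k./2).+1.
  rewrite -[RHS]doubleK; congr half.
  by have := odd_double_half k; rewrite (negbTE ek); nia.
case: b => /=; first by rewrite EN iter_code_rot_neg1_end (negbTE ek) addn0.
have := iter_code_rot_neg2_end; rewrite uphalf_half (negbTE ek) add0n -EN => ->.
by rewrite addn1.
Qed.

Lemma iter_vperiod x : iter vperiod vrot x = x.
Proof.
have [n ->] := vertex_reach x; rewrite -iterD addnC iterD.
by case: ifP => _; rewrite iter_vperiod_neg.
Qed.

Lemma iter_vperiodM n x : iter (n * vperiod) vrot x = x.
Proof. by elim: n => // n IH; rewrite mulSn iterD IH iter_vperiod. Qed.

Lemma iter_vrot_mod n x : iter n vrot x = iter (n %% vperiod) vrot x.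
Proof. by rewrite {1}(divn_eq n vperiod) addnC iterD iter_vperiodM. Qed.

Lemma vrot_inj : injective vrot.
Proof.
move=> x y exy; rewrite -[x]iter_vperiod -[y]iter_vperiod.
by rewrite -(prednK vperiod_gt0) !iterSr exy.
Qed.

Lemma iter_vrot_inj n : injective (iter n vrot).
Proof. by elim: n => //= n IH x y /vrot_inj/IH. Qed.

Lemma card_vertex : #|vertex| = N.
Proof. by rewrite card_sum card_prod !card_ord card_bool mulnC. Qed.

Lemma vperiod_dvd_N : vperiod %| N.
Proof.
have [ok|ek] := boolP (odd k); first by rewrite /vperiod ok.
by rewrite (N_even ek) -muln2 dvdn_mulr.
Qed.

Lemma odd_code_vrot x : ~~ odd k -> odd (code (vrot x)).1 = odd (code x).1.
Proof.
move=> ek; rewrite code_vrot /code_rot; case: ifP => //= _.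
by case: ifP => h; lia.
Qed.

Lemma odd_code_iter_vrot n x : ~~ odd k ->
  odd (code (iter n vrot x)).1 = odd (code x).1.
Proof. by move=> ek; elim: n => //= n IH; rewrite odd_code_vrot. Qed.

(** No shorter period exists, by counting: the iterates below [vperiod] of one negative simple root
    (odd [k]) or of both (even [k]) cover all vertices, and there are exactly [N] of these
    iterates. *)
Lemma iter_vrot_neg_fix n b : iter n vrot (inr b) = inr b -> vperiod %| n.
Proof.
rewrite iter_vrot_mod /dvdn; have := ltn_pmod n vperiod_gt0.
set r := n %% _ => rp; have [ok|ek] := boolP (odd k).
  have vN : vperiod = N by rewrite /vperiod ok.
  have ginj : injective (fun i : 'I_vperiod => iter i vrot (inr b)).
    apply: surj_inj_card; first by rewrite card_ord card_vertex.
    have reach1 x : exists s, x = iter s vrot neg1.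
      have [s Es] := vertex_reach x; move: Es; case: ifP => _ ->; first by exists s.
      exists (s + (m * k./2).+1); rewrite iterD; congr iter; apply: code_inj.
      by rewrite code_iter_vrot iter_code_rot_neg1_end ok addn1.
    have reachb x : exists s, x = iter s vrot (inr b).
      case: b => //; have [s ->] := reach1 x.
      exists (s + (m * uphalf k).+1); rewrite iterD; congr iter; apply: code_inj.
      by rewrite code_iter_vrot iter_code_rot_neg2_end ok addn0.
    move=> y; have [s ->] := reachb y.
    by exists (Ordinal (ltn_pmod s vperiod_gt0)); rewrite iter_vrot_mod.
  by move=> E; have := ginj (Ordinal rp) (Ordinal vperiod_gt0) E => -[->].
have ginj : injective (fun i : bool * 'I_vperiod => iter i.2 vrot (inr i.1)).
  apply: surj_inj_card.
    by rewrite card_prod card_bool card_ord card_vertex (N_even ek) mul2n.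
  move=> y; have [s ->] := vertex_reach y.
  exists (odd (code y).1 == odd k, Ordinal (ltn_pmod s vperiod_gt0)).
  by rewrite iter_vrot_mod; case: eqP.
by move=> E; have := ginj (b, Ordinal rp) (b, Ordinal vperiod_gt0) E => -[->].
Qed.

Lemma iter_vrot_fix n x : (iter n vrot x == x) = (vperiod %| n).
Proof.
apply/eqP/idP => [|/dvdnP[q ->]]; last by rewrite iter_vperiodM.
have [s ->] := vertex_reach x; rewrite -iterD addnC iterD => /iter_vrot_inj.
by case: ifP => _; apply: iter_vrot_neg_fix.
Qed.

Lemma iter_vrot_N x : iter N vrot x = x.
Proof. by apply/eqP; rewrite iter_vrot_fix vperiod_dvd_N. Qed.

(** * Adjacency and its invariance under rotation *)

Lemma adj_sym x y : adj x y = adj y x.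
Proof. by rewrite /adj /code_adj orbC. Qed.

Lemma adj_irrefl x : adj x x = false.
Proof. by apply/negbTE/code_adj_irrefl/code_validP. Qed.

Lemma arrow_asym x y : arrow x y -> ~~ arrow y x.
Proof. by apply: code_arrow_asym; apply: code_validP. Qed.

Lemma adj_triangle x y z : adj x y -> adj y z -> ~~ adj x z.
Proof. by apply: code_adj_triangle; apply: code_validP. Qed.

Lemma adj_iter_vrot_imp n x y : adj x y -> adj (iter n vrot x) (iter n vrot y).
Proof.
move=> xy; elim: n => //= n IH; rewrite /adj !code_vrot.
by apply: code_adj_rot => //; apply: code_validP.
Qed.

(** For the converse, rotate further until the total is a multiple of [vperiod]. *)
Lemma adj_iter_vrot n x y : adj (iter n vrot x) (iter n vrot y) = adj x y.
Proof.
apply/idP/idP => [|/adj_iter_vrot_imp//] /(adj_iter_vrot_imp (vperiod * n - n)).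
rewrite -!iterD subnK; last by rewrite leq_pmull ?vperiod_gt0.
by rewrite mulnC !iter_vperiodM.
Qed.

(** The indices [k.-1] and [k.+1] are those of alpha_2 and - alpha_2, the roots without alpha_1
    component. *)
Lemma adj_neg1 y : adj neg1 y = ((code y).1 == k.-1) || ((code y).1 == k.+1).
Proof.
have := code_validP y; rewrite /adj /code_adj /code_arrow /code_valid /=.
by case: (code y) => j i /=; lia.
Qed.

Lemma adj_neg2 y : adj neg2 y = ((code y).1 == 0) || ((code y).1 == k).
Proof.
have := code_validP y; rewrite /adj /code_adj /code_arrow /code_valid /=.
by case: (code y) => j i /=; lia.
Qed.

(** The neighbours are the [m] colored copies of the other simple root and the other negative simple
    root, which [g] enumerates. *)
Lemma card_adj_neg b : #|[pred y | adj (inr b) y]| = m.+1.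
Proof.
pose j0 : 'I_k := Ordinal (ltn_trans (ltn0Sn 1) hk).
pose jl : 'I_k := Ordinal (etrans (congr1 (fun n => n <= k) (prednK (ltn_trans (ltn0Sn 1) hk))) (leqnn k)).
pose g (o : option 'I_m) : vertex :=
  if o is Some i then inl (if b then jl else j0, i) else inr (~~ b).
have gi : injective g by move=> [i|] [i'|] //= [->].
transitivity #|[pred y in codom g]|; last first.
  by rewrite (card_codom gi) card_option card_ord.
apply: eq_card => y; rewrite !inE; apply/idP/idP.
  case: b @g gi => g gi; rewrite -/neg1 -/neg2 ?adj_neg1 ?adj_neg2.
    case: y => [[j i]|[]] /= h; [|lia|exact: (codom_f g None)].
    have -> : j = jl by apply: val_inj => /=; have := ltn_ord j; lia.
    exact: (codom_f g (Some i)).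
  case: y => [[j i]|[]] /= h; [|exact: (codom_f g None)|lia].
  have -> : j = j0 by apply: val_inj => /=; have := ltn_ord j; lia.
  exact: (codom_f g (Some i)).
case/codomP=> o ->; case: o => [i|] /=; case: (b);
  rewrite -/neg1 -/neg2 ?adj_neg1 ?adj_neg2 /=; lia.
Qed.

Lemma card_adj x : #|[pred y | adj x y]| = m.+1.
Proof.
suff H n b : #|[pred y | adj (iter n vrot (inr b)) y]| = m.+1.
  by have [n ->] := vertex_reach x; case: ifP => _; apply: H.
rewrite -(card_adj_neg b) -[RHS](card_image (@iter_vrot_inj n)).
apply: eq_card => y; rewrite !inE.
have -> : y = iter n vrot (iter (vperiod * n - n) vrot y).
  by rewrite -iterD subnKC ?leq_pmull ?vperiod_gt0 // mulnC iter_vperiodM.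
by rewrite adj_iter_vrot (fintype.mem_image (@iter_vrot_inj n)) inE.
Qed.

(** * Counting the edges fixed by a rotation *)

Definition pair_fixed n (p : vertex * vertex) : bool :=
  (iter n vrot p.1 == p.1) && (iter n vrot p.2 == p.2)
  || (iter n vrot p.1 == p.2) && (iter n vrot p.2 == p.1).

(** By asymmetry each edge carries exactly one arrow, and [swap] matches the two orderings of its
    ends. *)
Lemma double_card_arrow n :
  #|[pred p | arrow p.1 p.2 & pair_fixed n p]|.*2 =
  #|[pred p | adj p.1 p.2 & pair_fixed n p]|.
Proof.
pose swap (p : vertex * vertex) := (p.2, p.1).
have swapI : injective swap by move=> [x y] [x' y'] [-> ->].
set A := [pred p | arrow p.1 p.2 & _].
rewrite -(cardID A [pred p | adj p.1 p.2 & _]) -addnn; congr (_ + _).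
  apply: eq_card => -[x y]; rewrite !inE /= /adj /code_adj -/(arrow x y).
  by case: (arrow x y) => //=; rewrite ?andbb ?andbF.
rewrite -(card_image swapI); apply: eq_card => -[x y].
rewrite (_ : (x, y) = swap (y, x)) // (fintype.mem_image swapI) !inE /=.
have -> : pair_fixed n (x, y) = pair_fixed n (y, x).
  by rewrite /pair_fixed /= andbC [X in _ || X]andbC.
rewrite /adj /code_adj -/(arrow x y) -/(arrow y x).
have := @arrow_asym y x; case: (pair_fixed _ _); last by rewrite !andbF.
by rewrite !andbT; case: (arrow y x) (arrow x y) => -[] // /(_ isT).
Qed.

(** Adjacent indices differ by one modulo the even number [k]. As rotation keeps parity, it cannot
    exchange the ends of an edge. *)
Lemma adj_parity x y : ~~ odd k -> adj x y ->
  odd (code x).1 != odd (code y).1.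
Proof.
move=> ek; have := code_validP x; have := code_validP y.
rewrite /adj /code_adj /code_arrow /code_valid.
by case: (code x) (code y) => [j i] [j' i'] /=; lia.
Qed.

(* When [k] is odd, [N] = [2 p + m] where [p] steps lead from [- alpha_1] to
   [- alpha_2], so the half turn [N / 2] maps [- alpha_1] to [alpha_2^(m / 2)]. *)
Lemma adj_half_turn n x : odd k -> ~~ (N %| n) -> N %| n.*2 ->
  adj x (iter n vrot x).
Proof.
move=> ok nN dN.
have [s ->] : exists s, x = iter s vrot neg1.
  have [s Es] := vertex_reach x; move: Es; case: ifP => _ ->; first by exists s.
  exists (s + (m * k./2).+1); rewrite iterD; congr iter; apply: code_inj.
  by rewrite code_iter_vrot iter_code_rot_neg1_end ok addn1.
rewrite -iterD addnC iterD adj_iter_vrot.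
have vN : vperiod = N by rewrite /vperiod ok.
(* An even quotient would give [N %| n]. With [q] odd, [N] is even, so [m] is even too, and [n] is
   [N / 2] modulo [N]. *)
have [q Eq] := dvdnP dN; have oq : odd q.
  apply: contraNT nN => eq; apply/dvdnP; exists q./2.
  by apply: double_inj; rewrite Eq doubleMl -{1}[q]odd_double_half (negbTE eq).
have eN : ~~ odd N by have := congr1 odd Eq; rewrite odd_double oddM oq /= => <-.
have em : ~~ odd m by move: eN; rewrite oddD oddM ok andbT addbF.
have nE : n = q./2 * N + N./2.
  apply: double_inj; rewrite Eq -{1}[q]odd_double_half oq.
  by have := odd_double_half N; rewrite (negbTE eN); lia.
have -> : iter n vrot neg1 = iter N./2 vrot neg1.
  by rewrite nE addnC iterD -vN iter_vperiodM.
have -> : N./2 = m./2 + (m * k./2).+1.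
  have := odd_double_half k; have := odd_double_half m; rewrite ok (negbTE em).
  by set a := m./2; set b := k./2 => <- <-; lia.
rewrite iterD adj_neg1 !code_iter_vrot iter_code_rot_neg1_end ok addn1.
(* The first of the [m./2] remaining steps goes from - alpha_2 to alpha_2 and the others raise the
   color. *)
have m2 : m./2 = (m./2).-1.+1 by rewrite prednK //; lia.
rewrite m2 iterSr code_rot_neg2 iter_code_rot_color /=; [|lia..].
by rewrite eqxx.
Qed.

Lemma card_adj_pairs : #|[pred p : vertex * vertex | adj p.1 p.2]| = N * m.+1.
Proof.
rewrite -card_vertex -sum_nat_const -sum1_card.
rewrite -(pair_big_dep xpredT adj (fun _ _ => 1)) /=.
by apply: eq_bigr => x _; rewrite sum1_card card_adj.
Qed.

(** If [vperiod] does not divide [n], no vertex is fixed and the ends must be exchanged. Parity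
    forbids this for even [k]; for odd [k] it forces [N %| n.*2], and each vertex then forms such a
    pair with its image. *)
Lemma double_card_fixed_arrows n :
  #|[pred p | arrow p.1 p.2 & pair_fixed n p]|.*2 =
  if vperiod %| n then N * m.+1 else if N %| n.*2 then N else 0.
Proof.
rewrite double_card_arrow; case: ifP => vn.
  rewrite -card_adj_pairs; apply: eq_card => p.
  by rewrite !inE /pair_fixed !iter_vrot_fix vn /= andbT.
have [ok|ek] := boolP (odd k).
  have vN : vperiod = N by rewrite /vperiod ok.
  case: ifP => n2; last first.
    apply: eq_card0 => -[x y]; rewrite !inE /pair_fixed !iter_vrot_fix vn /=.
    apply/negP => /and3P[_ /eqP<-]; rewrite -iterD iter_vrot_fix addnn vN n2 //.
  have gi : injective (fun x => (x, iter n vrot x)) by move=> x y [].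
  rewrite -card_vertex -(card_codom gi); apply: eq_card => -[x y].
  rewrite !inE /pair_fixed /= !iter_vrot_fix vn /=; apply/idP/codomP.
    by case/and3P=> _ /eqP<- _; exists x.
  case=> z [-> ->]; rewrite eqxx -iterD iter_vrot_fix addnn vN n2 !andbT.
  by rewrite adj_half_turn // -vN vn.
rewrite (N_even ek) -!muln2 dvdn_pmul2r // vn.
apply: eq_card0 => -[x y]; rewrite !inE /pair_fixed !iter_vrot_fix vn /=.
apply/negP => /and3P[xy /eqP E _].
by have := adj_parity ek xy; rewrite -E odd_code_iter_vrot // eqxx.
Qed.

Lemma card_parity_class b : ~~ odd k ->
  #|[pred x : vertex | odd (code x).1 == b]| = vperiod.
Proof.
move=> ek; have gi : injective (fun i : 'I_vperiod => iter i vrot (inr (~~ b))).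
  move=> i j; wlog ij : i j / i <= j.
    by move=> W E; have [/W->//|/ltnW/W->//] := leqP i j.
  move=> E; apply: val_inj; have : iter (j - i) vrot (inr (~~ b)) == inr (~~ b).
    by apply/eqP; apply: (@iter_vrot_inj i); rewrite -iterD subnKC.
  rewrite iter_vrot_fix => /dvdnP[q Eq]; have := ltn_ord j.
  by case: q Eq => [|q] Eq /=; [lia|rewrite mulSn in Eq; lia].
rewrite -[RHS]card_ord -(card_codom gi); apply: eq_card => x; rewrite !inE.
apply/eqP/codomP => [xb|[i ->]]; last first.
  by rewrite odd_code_iter_vrot //=; case: (b); rewrite /= (negbTE ek).
have [n ->] := vertex_reach x; rewrite xb (negbTE ek).
exists (Ordinal (ltn_pmod n vperiod_gt0)); rewrite iter_vrot_mod /=.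
by case: (b).
Qed.

End Combinatorics.

(** * Plane reflections *)

Section UnitVectors.
Variable R : realType.
Local Open Scope ring_scope.
Implicit Types a b s t : R.

(** Cosine is injective on [0, pi]; an angle beyond pi is replaced by 2 pi - t. *)
Lemma cos_eq1 t : 0 <= t < pi *+ 2 -> cos t = 1 -> t = 0.
Proof.
move=> /andP[t0 t2] ct; have pi0 := pi_gt0 R.
have [tp|tp] := leP t pi.
  by apply: cos_inj; rewrite ?in_itv /= ?t0 ?tp ?lexx ?pi_ge0 // ct cos0.
have : cos (pi *+ 2 - t) = cos 0.
  by rewrite cosB cos2pi sin2pi ct cos0 mul0r addr0 mulr1.
move=> /cos_inj; rewrite !in_itv /= lexx pi_ge0 => /(_ _ isT) E.
suff : pi *+ 2 - t = 0 by lra.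
by apply: E; lra.
Qed.

Definition uvec t : 'cV[R]_2 := \col_(i < 2) (if i == 0 then cos t else sin t).

Lemma ord2P (i : 'I_2) : i = 0 \/ i = 1.
Proof. by case: i => [[|[|//]] h]; [left|right]; apply: val_inj. Qed.

Lemma cV2P (u v : 'cV[R]_2) : u 0 0 = v 0 0 -> u 1 0 = v 1 0 -> u = v.
Proof.
by move=> e0 e1; apply/colP => i; have [->//|->//] := ord2P i.
Qed.

Lemma uvec0 t : uvec t 0 0 = cos t. Proof. by rewrite mxE. Qed.
Lemma uvec1 t : uvec t 1 0 = sin t. Proof. by rewrite mxE. Qed.

Lemma uvecDpi t : uvec (t + pi) = - uvec t.
Proof. by apply: cV2P; rewrite [RHS]mxE ?uvec0 ?uvec1 ?cosDpi ?sinDpi. Qed.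

Lemma uvecD2pi t n : uvec (t + pi *+ 2 *+ n) = uvec t.
Proof.
elim: n => [|n IH]; first by rewrite addr0.
by rewrite mulrSr addrA mulr2n addrA !uvecDpi opprK -mulr2n.
Qed.

(** Natural multiples of the full turn on both sides stand for one integer multiple. The congruence
    lemmas below use [p] and [q] in the same way. *)
Lemma uvec_cong s t p q :
  s + p%:R * (2 * pi) = t + q%:R * (2 * pi) -> uvec s = uvec t.
Proof.
by rewrite !mulr_natl => E; rewrite -(uvecD2pi s p) E uvecD2pi.
Qed.

Lemma uvec_neq0 t : uvec t != 0.
Proof.
apply/eqP => E; have := cos2Dsin2 t.
by rewrite -uvec0 -uvec1 E !mxE expr0n addr0 => /eqP; rewrite eq_sym oner_eq0.
Qed.

Lemma uvecD_eq s t : 0 <= t < pi *+ 2 -> uvec (s + t) = uvec s -> t = 0.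
Proof.
move=> ht E; apply: cos_eq1 => //.
have Ec : cos (s + t) = cos s by rewrite -!uvec0 E.
have Es : sin (s + t) = sin s by rewrite -!uvec1 E.
have -> : t = (s + t) - s by ring.
by rewrite cosB Ec Es -!expr2 cos2Dsin2.
Qed.

Lemma uvec_dot s t : ((uvec s)^T *m uvec t) 0 0 = cos (s - t).
Proof. by rewrite !mxE 2!big_ord_recl big_ord0 !mxE /= addr0 cosB. Qed.

Lemma reflE t (v : 'cV[R]_2) :
  refl (uvec t) *m v = v - (2 * ((uvec t)^T *m v) 0 0) *: uvec t.
Proof.
rewrite /refl uvec_dot subrr cos0 divr1 mulmxBl mul1mx -scalemxAl -mulmxA.
by rewrite {1}[_^T *m v]mx11_scalar mul_mx_scalar scalerA.
Qed.

(** The mirror is the line at angle t + pi / 2, so angles are reversed about it. *)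
Lemma refl_uvec t s : refl (uvec t) *m uvec s = uvec (t *+ 2 + pi - s).
Proof.
rewrite reflE uvec_dot; have E := cos2sin2 t.
have -> : t *+ 2 + pi - s = (t - s + t) + pi by rewrite mulr2n; ring.
rewrite uvecDpi; apply: cV2P; rewrite !mxE /= !(cosD, sinD, cosN, sinN).
  by ring: E.
by ring: E.
Qed.

(** The directions 0 and pi / 2 recover the columns. Matrix identities thereby become additions of
    angles. *)
Lemma mx2_uvecP (A B : 'M[R]_2) : (forall s, A *m uvec s = B *m uvec s) -> A = B.
Proof.
move=> E; have col s i : (A *m uvec s) i 0 = (B *m uvec s) i 0 by rewrite E.
have expd (M : 'M[R]_2) s i : (M *m uvec s) i 0 = M i 0 * cos s + M i 1 * sin s.
  rewrite mxE 2!big_ord_recl big_ord0 !mxE /= addr0.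
  by congr (_ + M i _ * _); apply: val_inj.
apply/matrixP => i j; have [->|->] := ord2P j.
  by have := col 0 i; rewrite !expd cos0 sin0 !mulr0 !addr0 !mulr1.
by have := col (pi / 2) i; rewrite !expd cos_pihalf sin_pihalf !mulr0 !add0r !mulr1.
Qed.

Lemma refl_uvecK t : refl (uvec t) * refl (uvec t) = 1.
Proof.
apply: mx2_uvecP => s; rewrite -mulmxE -mulmxA !refl_uvec mul1mx.
by congr uvec; ring.
Qed.

Lemma refl_uvec_fix t (v : 'cV[R]_2) :
  refl (uvec t) *m v = v <-> ((uvec t)^T *m v) 0 0 = 0.
Proof.
rewrite reflE; split=> [|->]; last by rewrite mulr0 scale0r subr0.
move=> /eqP; rewrite subr_eq addrC -subr_eq subrr eq_sym scaler_eq0.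
by rewrite (negbTE (uvec_neq0 t)) orbF mulf_eq0 pnatr_eq0 => /eqP.
Qed.

Lemma det_mx22 (A : 'M[R]_2) : \det A = A 0 0 * A 1 1 - A 0 1 * A 1 0.
Proof.
rewrite (expand_det_row _ 0) 2!big_ord_recl big_ord0 addr0.
rewrite /cofactor !det_mx11 !mxE /= expr0 expr1 mul1r mulN1r mulrN.
by congr (_ * A _ _ - A _ _ * A _ _); apply: val_inj.
Qed.

Lemma det_refl_uvec t : \det (refl (uvec t)) = -1.
Proof.
have E := cos2sin2 t.
rewrite /refl uvec_dot subrr cos0 divr1 det_mx22 !mxE !big_ord1 !mxE /=.
by rewrite !(mulr1n, mulr0n); ring: E.
Qed.

Lemma dot_uvec (t : R) (v : 'cV[R]_2) :
  ((uvec t)^T *m v) 0 0 = cos t * v 0 0 + sin t * v 1 0.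
Proof.
rewrite mxE 2!big_ord_recl big_ord0 !mxE /= addr0.
by congr (_ + _ * v _ _); apply: val_inj.
Qed.

(** Two unit vectors orthogonal to the same nonzero vector are equal or opposite, and a sign does
    not change the reflection. *)
Lemma uvec_orth_eq_refl a b (v : 'cV[R]_2) : v != 0 ->
  ((uvec a)^T *m v) 0 0 = 0 -> ((uvec b)^T *m v) 0 0 = 0 ->
  refl (uvec a) = refl (uvec b).
Proof.
rewrite !dot_uvec => v0 ha hb.
have Ea := cos2Dsin2 a; have Eb := cos2Dsin2 b.
have sab : sin (a - b) = 0.
  rewrite sinB; have e0 : (sin a * cos b - cos a * sin b) * v 0 0 = 0.
    transitivity (sin a * (cos b * v 0 0 + sin b * v 1 0)
                  - sin b * (cos a * v 0 0 + sin a * v 1 0)); first by ring.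
    by rewrite ha hb; ring.
  have e1 : (sin a * cos b - cos a * sin b) * v 1 0 = 0.
    transitivity (cos b * (cos a * v 0 0 + sin a * v 1 0)
                  - cos a * (cos b * v 0 0 + sin b * v 1 0)); first by ring.
    by rewrite ha hb; ring.
  apply/eqP; apply: contraNT v0 => /negbTE nz.
  move/eqP: e0; rewrite mulf_eq0 nz /= => /eqP e0.
  move/eqP: e1; rewrite mulf_eq0 nz /= => /eqP e1.
  by apply/eqP/cV2P; rewrite ?e0 ?e1 mxE.
have uab : uvec a = uvec b \/ uvec a = - uvec b.
  have [d Ed sd] : exists2 d, a = d + b & sin d = 0 by exists (a - b); first ring.
  have /eqP := sin0cos1 sd; rewrite eqr_norml ler01 andbT Ed => /orP[] /eqP c1;
    [left|right]; apply: cV2P; rewrite !mxE /= ?cosD ?sinD sd c1; ring.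
case: uab => ->//; have tN : (- uvec b)^T = - (uvec b)^T by rewrite raddfN.
by rewrite /refl tN !mulNmx !mulmxN !opprK.
Qed.

End UnitVectors.

(** * The dihedral group *)

Section DihedralGroup.
Variables (R : realType) (k : nat).
Hypothesis hk : (2 < k)%N.
Local Open Scope ring_scope.
Implicit Types (a b c i j n p q : nat) (s t : R).

Local Notation ang j := (j%:R * pi / k%:R : R).
Local Notation rho := (rootvec R k).
Local Notation T j := (refl (rho j)).

Lemma rootvecE j : rho j = uvec (ang j). Proof. by []. Qed.

Lemma k_neq0 : k%:R != 0 :> R. Proof. by rewrite pnatr_eq0; lia. Qed.

Lemma pi_angle : pi = ang k. Proof. by field; exact: k_neq0. Qed.

Lemma rootvec_cong i j p q : (i + 2 * k * p = j + 2 * k * q)%N -> rho i = rho j.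
Proof.
move=> /(congr1 (fun n => n%:R : R)); rewrite !(natrD, natrM) => E.
apply: (@uvec_cong _ _ _ p q); apply: (mulIf k_neq0).
transitivity ((i%:R + 2 * k%:R * p%:R) * pi : R); first by field; exact: k_neq0.
by rewrite E; field; exact: k_neq0.
Qed.

Lemma rootvecDk j : rho (j + k) = - rho j.
Proof.
rewrite !rootvecE -uvecDpi; congr uvec; rewrite natrD; field; exact: k_neq0.
Qed.

Lemma ang_lt i : (i < 2 * k)%N -> 0 <= ang i < pi *+ 2.
Proof.
move=> h; have p0 := pi_gt0 R.
have k0 : 0 < k%:R :> R by rewrite lt_def k_neq0 ler0n.
rewrite divr_ge0 ?mulr_ge0 ?ler0n ?(ltW p0) //= ltr_pdivrMr //.
by rewrite -[pi *+ 2]mulr_natl mulrAC ltr_pM2r // -natrM ltr_nat.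
Qed.

Lemma rootvec_inj i j : (i < 2 * k)%N -> (j < 2 * k)%N -> rho i = rho j -> i = j.
Proof.
wlog ij : i j / (i <= j)%N.
  move=> W hi hj E; have [ij|/ltnW ij] := leqP i j; first exact: W.
  by apply/esym/W.
move=> hi hj; rewrite -(subnKC ij) !rootvecE natrD !mulrDl => /esym.
move=> /(uvecD_eq (ang_lt (leq_ltn_trans (leq_subr _ _) hj)))/eqP.
rewrite !mulf_eq0 invr_eq0 (negbTE k_neq0) orbF pnatr_eq0 (gt_eqF (pi_gt0 R)) ?orbF.
by move=> /eqP ->; rewrite addn0.
Qed.

Lemma refl_rootvec a b c p q : (b + c + 2 * k * p = 2 * a + k + 2 * k * q)%N ->
  T a *m rho b = rho c.
Proof.
move=> /(congr1 (fun n => n%:R : R)); rewrite !(natrD, natrM) => E.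
rewrite !rootvecE refl_uvec; apply: (@uvec_cong _ _ _ q p); apply: (mulIf k_neq0).
transitivity ((2 * a%:R + k%:R + 2 * k%:R * q%:R - b%:R) * pi : R); first by field; exact: k_neq0.
by rewrite -E; field; exact: k_neq0.
Qed.

Lemma alpha1E : alpha1 R k = rho 0. Proof. by []. Qed.
Lemma alpha2E : alpha2 R k = rho k.-1. Proof. by []. Qed.

Definition rotm n : 'M[R]_2 := cox R k ^+ n.

Lemma cox_uvec s : cox R k *m uvec s = uvec (s + ang 2).
Proof.
rewrite /cox /c_plus /c_minus alpha1E alpha2E -mulmxE -mulmxA !rootvecE !refl_uvec.
(* The product turns by twice the angle between the mirrors, -2 (k - 1) pi / k, which is 2 pi / k up
   to one full turn. *)
apply: (@uvec_cong _ _ _ 1 0); rewrite -subn1 natrB; last by lia.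
by field; exact: k_neq0.
Qed.

Lemma rotm_uvec n s : rotm n *m uvec s = uvec (s + ang (2 * n)).
Proof.
rewrite /rotm; elim: n s => [|n IH] s; first by rewrite expr0 mul1mx muln0 !mul0r addr0.
rewrite exprSr -mulmxE -mulmxA cox_uvec IH; congr uvec.
by rewrite mulnS natrD; field; exact: k_neq0.
Qed.

Lemma rotmD p q : rotm (p + q) = rotm p * rotm q.
Proof. by rewrite /rotm exprD. Qed.

Lemma rotm_cong a b p q : (a + k * p = b + k * q)%N -> rotm a = rotm b.
Proof.
move=> /(congr1 (fun n => n%:R : R)); rewrite !(natrD, natrM) => E.
apply: mx2_uvecP => s; rewrite !rotm_uvec.
apply: (@uvec_cong _ _ _ p q); rewrite !natrM; apply: (mulIf k_neq0).
transitivity (s * k%:R + 2 * (a%:R + k%:R * p%:R) * pi : R); first by field; exact: k_neq0.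
by rewrite E; field; exact: k_neq0.
Qed.

Lemma rotm_eq1 n : rotm n = 1 -> (k %| n)%N.
Proof.
move=> E; rewrite /dvdn; have nk : (n %% k < k)%N by rewrite ltn_pmod //; lia.
have : rotm (n %% k) = 1.
  by rewrite -E; apply: (@rotm_cong _ _ (n %/ k) 0); rewrite muln0 addn0 mulnC addnC -divn_eq.
have nk2 : (2 * (n %% k) < 2 * k)%N by rewrite ltn_mul2l.
move=> /(congr1 (mulmx^~ (uvec 0))); rewrite rotm_uvec mul1mx.
move=> /(uvecD_eq (ang_lt nk2))/eqP; rewrite !mulf_eq0 invr_eq0 (negbTE k_neq0) orbF.
by rewrite pnatr_eq0 (gt_eqF (pi_gt0 R)) ?orbF muln_eq0.
Qed.

(** The hypothesis says that [c] is [a - b] modulo [k]: the product of two reflections turns by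
    twice the difference of their angles, and [rotm] counts in units of 2 pi / k. *)
Lemma refl_mul_refl a b c p q : (a + k * p = b + c + k * q)%N ->
  T a * T b = rotm c.
Proof.
move=> /(congr1 (fun n => n%:R : R)); rewrite !(natrD, natrM) => E.
apply: mx2_uvecP => s; rewrite -mulmxE -mulmxA !rootvecE !refl_uvec rotm_uvec.
apply: (@uvec_cong _ _ _ p q); rewrite !natrM; apply: (mulIf k_neq0).
transitivity (s * k%:R + 2 * pi * ((a%:R + k%:R * p%:R) - b%:R) : R); first by field; exact: k_neq0.
by rewrite E; field; exact: k_neq0.
Qed.

Lemma rotm_mul_refl a b : rotm a * T b = T (a + b).
Proof.
apply: mx2_uvecP => s; rewrite -mulmxE -mulmxA !rootvecE !refl_uvec rotm_uvec.
by congr uvec; rewrite natrD natrM; field; exact: k_neq0.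
Qed.

Lemma refl_mul_rotm a b c p q : (a + k * p = b + c + k * q)%N -> T a * rotm b = T c.
Proof.
move=> /(congr1 (fun n => n%:R : R)); rewrite !(natrD, natrM) => E.
apply: mx2_uvecP => s; rewrite -mulmxE -mulmxA !rootvecE rotm_uvec !refl_uvec.
apply: (@uvec_cong _ _ _ p q); rewrite !natrM; apply: (mulIf k_neq0).
transitivity (pi * k%:R - s * k%:R + 2 * pi * ((a%:R + k%:R * p%:R) - b%:R) : R).
  by field; exact: k_neq0.
by rewrite E; field; exact: k_neq0.
Qed.

Lemma reflK a : T a * T a = 1.
Proof. exact: refl_uvecK. Qed.

Lemma refl_cong a b p q : (a + k * p = b + k * q)%N -> T a = T b.
Proof. by move=> E; rewrite -[LHS]mulr1 -[1](expr0 (cox R k)); apply: (@refl_mul_rotm a 0 b p q). Qed.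

Lemma refl_eq a b : T a = T b -> a = b %[mod k].
Proof.
wlog ab : a b / (b <= a)%N.
  by move=> W E; have [ab|/ltnW ab] := leqP a b; [apply/esym|]; apply: W.
move=> E; have := reflK b; rewrite -{1}E.
rewrite (@refl_mul_refl a b (a - b) 0 0); last by rewrite subnKC.
by move=> /rotm_eq1; rewrite -eqn_mod_dvd // => /eqP.
Qed.

Lemma det_refl a : \det (T a) = -1. Proof. exact: det_refl_uvec. Qed.

Lemma det_rotm n : \det (rotm n) = 1.
Proof.
rewrite /rotm; elim: n => [|n IH]; first by rewrite expr0 det1.
by rewrite exprS -mulmxE !det_mulmx IH !det_refl mulrNN !mulr1.
Qed.

Lemma rotm_neq_refl a b : rotm a != T b.
Proof.
apply/eqP => /(congr1 determinant); rewrite det_rotm det_refl => E.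
by lra.
Qed.

Lemma c_plusE : c_plus R k = T 0. Proof. by []. Qed.
Lemma c_minusE : c_minus R k = T k.-1. Proof. by []. Qed.

Lemma weylM (u w : 'M[R]_2) : weyl k u -> weyl k w -> weyl k (u * w).
Proof.
move=> [s1 h1 ->] [s2 h2 ->]; exists (s1 ++ s2); last by rewrite /reflprod big_cat.
by move=> x; rewrite mem_cat => /orP[/h1|/h2].
Qed.

Lemma weyl1 : weyl k (1 : 'M[R]_2).
Proof. by exists [::]; rewrite // /reflprod big_nil. Qed.

Lemma weyl_simple (x : 'cV[R]_2) : x \in (simple R k : seq _) -> weyl k (refl x).
Proof.
move=> h; exists [:: x]; last by rewrite /reflprod big_seq1.
by move=> y; rewrite inE => /eqP->.
Qed.

Lemma weyl_refl0 : weyl k (T 0).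
Proof. by apply: weyl_simple; rewrite inE eqxx. Qed.

Lemma weyl_rotm n : weyl k (rotm n).
Proof.
rewrite /rotm; elim: n => [|n IH]; first by rewrite expr0; apply: weyl1.
rewrite exprS; apply: weylM IH; apply: weylM; first exact: weyl_refl0.
by apply: weyl_simple; rewrite !inE eqxx orbT.
Qed.

Lemma weyl_refl n : weyl k (T n).
Proof.
have := rotm_mul_refl n 0; rewrite addn0 => <-.
by apply: weylM; [apply: weyl_rotm|apply: weyl_refl0].
Qed.

Lemma weylP (w : 'M[R]_2) :
  weyl k w -> (exists n, w = rotm n) \/ (exists n, w = T n).
Proof.
move=> [s hs ->]; elim: s hs => [|x s IH] hs.
  by left; exists 0%N; rewrite /reflprod big_nil /rotm expr0.
have {IH} : (exists n, reflprod s = rotm n) \/ (exists n, reflprod s = T n).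
  by apply: IH => y ys; apply: hs; rewrite inE ys orbT.
have [n0 ->] : exists n, x = rho n.
  by have := hs x (mem_head _ _); rewrite !inE => /orP[]/eqP->; eexists.
rewrite /reflprod big_cons => -[] [n ->].
  (* Here and below, multiplication by [k.-1] is negation modulo [k]. *)
  right; exists (n0 + n * k.-1)%N; apply: (@refl_mul_rotm _ _ _ n 0); nia.
left; exists (n0 + n * k.-1)%N; apply: (@refl_mul_refl _ _ _ n 0); nia.
Qed.

Lemma weyl_unit (w : 'M[R]_2) : weyl k w -> w \is a GRing.unit.
Proof.
move=> /weylP; case=> -[n ->].
  by rewrite unitmxE det_rotm unitr1.
by rewrite unitmxE det_refl unitrN1.
Qed.

Lemma refl_inv n : (T n)^-1 = T n.
Proof.
by apply: (mulrI (weyl_unit (weyl_refl n))); rewrite mulrV ?reflK // (weyl_unit (weyl_refl n)).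
Qed.

Lemma rotm_inv n : (rotm n)^-1 = rotm (n * k.-1).
Proof.
have u := weyl_unit (weyl_rotm n); apply: (mulrI u); rewrite mulrV // -rotmD.
rewrite (_ : 1 = rotm 0) //; apply: (@rotm_cong _ _ n 0); nia.
Qed.

Lemma weylV (w : 'M[R]_2) : weyl k w -> weyl k w^-1.
Proof.
move=> /weylP; case=> -[n ->]; first by rewrite rotm_inv; apply: weyl_rotm.
by rewrite refl_inv; apply: weyl_refl.
Qed.

(** For a rotation by t fixing v = (x, y), pairing the image with v gives (x^2 + y^2) cos t = x^2 +
    y^2, so cos t = 1 and sin t = 0. *)
Lemma rotm_fix n (v : 'cV[R]_2) : v != 0 -> rotm n *m v = v -> rotm n = 1.
Proof.
move=> v0 E; have [t Et] : exists t, forall s, rotm n *m uvec s = uvec (s + t).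
  by exists (ang (2 * n)); apply: rotm_uvec.
have Ev : v = v 0 0 *: uvec 0 + v 1 0 *: uvec (pi / 2).
  apply: cV2P; rewrite !mxE /= ?cos0 ?sin0 ?cos_pihalf ?sin_pihalf; ring.
have E0 : v = v 0 0 *: uvec t + v 1 0 *: uvec (pi / 2 + t).
  by rewrite -{1}E {1}Ev mulmxDr -!scalemxAr !Et add0r.
have := congr1 (fun w : 'cV[R]_2 => w 0 0) E0.
have := congr1 (fun w : 'cV[R]_2 => w 1 0) E0.
rewrite !mxE /= !(cosD, sinD) cos_pihalf sin_pihalf !(mul0r, mul1r, add0r, addr0, sub0r) => e1 e0.
have := cos2Dsin2 t => E1.
have n0 : v 0 0 ^+ 2 + v 1 0 ^+ 2 != 0.
  apply: contra_neq v0 => h; apply: cV2P; rewrite mxE.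
    by apply/eqP; rewrite -sqrf_eq0; apply/eqP; nra.
  by apply/eqP; rewrite -sqrf_eq0; apply/eqP; nra.
have ct : cos t = 1.
  apply: (mulfI n0); move: e0 e1; set x := v 0 0; set y := v 1 0 => e0 e1.
  transitivity (x * (x * cos t + y * - sin t) + y * (x * sin t + y * cos t)).
    by ring.
  by rewrite -e0 -e1; ring.
have st : sin t = 0 by apply/eqP; rewrite -sqrf_eq0; apply/eqP; nra.
apply: mx2_uvecP => s; rewrite Et mul1mx; apply: cV2P.
  by rewrite !mxE /= cosD ct st; ring.
by rewrite !mxE /= sinD ct st; ring.
Qed.

End DihedralGroup.

(** * Colored almost positive roots and compatibility *)

Section ColoredRoots.
Variables (R : realType) (k m : nat).
Hypotheses (hk : (2 < k)%N) (hm : (0 < m)%N).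
Local Open Scope ring_scope.

Local Notation ang j := (j%:R * pi / k%:R : R).
Local Notation rho := (rootvec R k).
Local Notation vertex := (vertex k m).

Lemma ang_bound j : (j <= k)%N -> 0 <= ang j <= pi.
Proof.
move=> jk; have p0 := pi_gt0 R.
have k0 : 0 < k%:R :> R by rewrite lt_def (k_neq0 R hk) ler0n.
rewrite divr_ge0 ?mulr_ge0 ?ler0n ?(ltW p0) //= ler_pdivrMr //.
by rewrite mulrC ler_pM2l // ler_nat.
Qed.

Lemma sin_ang_gt0 j : (0 < j < k)%N -> 0 < sin (ang j).
Proof.
move=> /andP[j0 jk]; have p0 := pi_gt0 R.
have k0 : 0 < k%:R :> R by rewrite lt_def (k_neq0 R hk) ler0n.
apply: sin_gt0_pi; apply/andP; split; first by rewrite divr_gt0 // mulr_gt0 // ltr0n.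
by rewrite ltr_pdivrMr // mulrC ltr_pM2l // ltr_nat.
Qed.

Lemma sin_ang0 : sin (ang 0) = 0. Proof. by rewrite !mul0r sin0. Qed.
Lemma sin_angk : sin (ang k) = 0. Proof. by rewrite -(pi_angle R hk) sinpi. Qed.

Lemma sin_ang_ge0 j : (j <= k)%N -> 0 <= sin (ang j).
Proof. by move=> /ang_bound; apply: sin_ge0_pi. Qed.

Lemma sin_angDk j : sin (ang (k + j)) = - sin (ang j).
Proof.
rewrite -sinDpi; congr sin; rewrite natrD; field; exact: (k_neq0 R hk).
Qed.

Local Notation S := (sin (ang k.-1)).

Lemma sin_ang_pred_gt0 : 0 < S.
Proof. by apply: sin_ang_gt0; lia. Qed.

Lemma simple_free : free (simple R k).
Proof.
apply/freeP => c; rewrite 2!big_ord_recl big_ord0 addr0 /= => E.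
have := congr1 (fun w : 'cV[R]_2 => w 1 0) E.
rewrite !mxE /= sin_ang0 mulr0 add0r => /eqP.
rewrite mulf_eq0 (gt_eqF sin_ang_pred_gt0) orbF => /eqP c1.
have := congr1 (fun w : 'cV[R]_2 => w 0 0) E.
rewrite !mxE /= c1 !mul0r addr0 cos0 mulr1 => c0.
case=> [[|[|//]] h]; [rewrite -[RHS]c0|rewrite -[RHS]c1]; congr c; exact: val_inj.
Qed.

(** Cramer's rule: [S] is the determinant of the simple basis, and each numerator is the determinant
    with one simple root replaced by [rho j]. *)
Lemma coord_rootvec (j : nat) (i : 'I_2) : coord (simple R k) i (rho j) =
  (if i == 0 then sin (ang k.-1 - ang j) else sin (ang j)) / S.
Proof.
pose c (i : 'I_2) : R := (if i == 0 then sin (ang k.-1 - ang j) else sin (ang j)) / S.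
rewrite -/(c i) -(coord_sum_free c i simple_free); congr coord.
rewrite 2!big_ord_recl big_ord0 addr0 /c /=; have S0 : S != 0 by rewrite (gt_eqF sin_ang_pred_gt0).
apply: cV2P; rewrite !mxE /=.
  by rewrite !mul0r cos0 mulr1 sinB; field.
by rewrite sin_ang0 mulr0 add0r divfK.
Qed.

Lemma coord0_low j : (j < k)%N ->
  coord (simple R k) 0 (rho j) = sin (ang (k.-1 - j)) / S.
Proof.
move=> jk; rewrite coord_rootvec /=; congr (sin _ / _).
by rewrite natrB; [rewrite -mulrBl -mulrBl | lia].
Qed.

Lemma coord0_high j : (k <= j)%N ->
  coord (simple R k) 0 (rho j) = - sin (ang (j - k.-1)) / S.
Proof.
move=> jk; rewrite coord_rootvec /= -sinN; congr (sin _ / _).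
by rewrite natrB; [rewrite -mulrBl -mulrBl -!mulNr opprB | lia].
Qed.

Lemma coord1E j : coord (simple R k) 1 (rho j) = sin (ang j) / S.
Proof. by rewrite coord_rootvec. Qed.

Lemma mem_pos_roots j : (j < 2 * k)%N -> (rho j \in pos_roots R k) = (j < k)%N.
Proof.
move=> j2; have S0 := sin_ang_pred_gt0; rewrite !inE /=.
have -> : rho j \in Defs.roots R k.
  by apply/imfsetP; exists j => //=; rewrite mem_iota.
have [jk|kj] := ltnP j k; apply/forallP; last first.
  (* At [j = k] the alpha_2 coefficient vanishes, so the negative one is that of alpha_1; beyond [k]
     the alpha_2 coefficient is negative. *)
  have [->|jk] := eqVneq j k => H.
    have := H 0; rewrite coord0_high // mulNr oppr_ge0 leNgt divr_gt0 //.
    by apply: sin_ang_gt0; lia.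
  have := H 1; rewrite coord1E -(subnKC kj) sin_angDk mulNr oppr_ge0 leNgt divr_gt0 //.
  by apply: sin_ang_gt0; lia.
move=> i; have [->|->] := ord2P i.
  by rewrite coord0_low // divr_ge0 ?(ltW S0) // sin_ang_ge0 //; lia.
by rewrite coord1E divr_ge0 ?(ltW S0) // sin_ang_ge0 // ltnW.
Qed.

Lemma pos_rootsP (b : 'cV[R]_2) :
  reflect (exists2 j, (j < k)%N & b = rho j) (b \in pos_roots R k).
Proof.
apply: (iffP idP) => [bp|[j jk ->]]; last by rewrite mem_pos_roots //; lia.
have : b \in Defs.roots R k by move: bp; rewrite !inE => /andP[].
move=> /imfsetP[j]; rewrite /= mem_iota add0n => /andP[_ j2] E.
by exists j => //; rewrite -mem_pos_roots // -E.
Qed.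

(** Among valid codes only [k.+1], that is - alpha_2 at angle index 2k - 1, differs from its angle
    index. *)
Definition root_index (j : nat) := if (j <= k)%N then j else (2 * k).-1.

Lemma root_index_lt j : (root_index j < 2 * k)%N.
Proof. by rewrite /root_index; case: ifP; lia. Qed.

Lemma coord0_eq0 j : (j <= k.+1)%N ->
  (coord (simple R k) 0 (rho (root_index j)) == 0) = (j == k.-1) || (j == k.+1).
Proof.
move=> jk; have S0 := sin_ang_pred_gt0; rewrite /root_index; case: (ltnP j k) => h1.
  rewrite (ltnW h1) coord0_low // mulf_eq0 invr_eq0 (gt_eqF S0) orbF.
  have [->|nj] := eqVneq j k.-1; first by rewrite subnn sin_ang0 eqxx.
  by rewrite gt_eqF ?sin_ang_gt0 //; lia.
case: (leqP j k) => h2.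
  have -> : j = k by lia.
  rewrite coord0_high // mulf_eq0 invr_eq0 (gt_eqF S0) orbF oppr_eq0.
  by rewrite gt_eqF ?sin_ang_gt0; lia.
have -> : j = k.+1 by lia.
rewrite coord0_high ?mulf_eq0 ?invr_eq0 ?(gt_eqF S0) ?orbF ?oppr_eq0; [|lia].
have -> : ((2 * k).-1 - k.-1 = k)%N by lia.
by rewrite sin_angk !eqxx orbT.
Qed.

Lemma coord1_eq0 j : (j <= k.+1)%N ->
  (coord (simple R k) 1 (rho (root_index j)) == 0) = (j == 0)%N || (j == k).
Proof.
move=> jk; have S0 := sin_ang_pred_gt0; rewrite coord1E mulf_eq0 invr_eq0 (gt_eqF S0) orbF.
rewrite /root_index; case: (ltngtP j k) => h1.
- have [->|nj] := eqVneq j 0%N; first by rewrite sin_ang0 eqxx.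
  by rewrite gt_eqF ?sin_ang_gt0 //; lia.
- have -> : ((2 * k).-1 = k + k.-1)%N by lia.
  rewrite sin_angDk oppr_eq0 gt_eqF ?sin_ang_pred_gt0 //; lia.
- by rewrite h1 sin_angk eqxx orbT.
Qed.

(** * Vertices as colored roots; uniqueness of compatibility *)

Definition croot_of (x : vertex) : 'cV[R]_2 * nat :=
  (rho (root_index (code x).1), (code x).2).

Lemma code_le (x : vertex) : ((code x).1 <= k.+1)%N.
Proof. by have := code_validP hk hm x; rewrite /code_valid; lia. Qed.

Lemma croot_of_inj : injective croot_of.
Proof.
move=> x y [] /(rootvec_inj hk (root_index_lt _) (root_index_lt _)) E1 E2.
apply: code_inj; have := code_le x; have := code_le y; move: E1 E2.
case: (code x) (code y) => [j i] [j' i'] /= + ->; rewrite /root_index => E hx hy.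
by congr (_, _); move: E; do 2!case: ifP; lia.
Qed.

Lemma neg_alpha1E : - alpha1 R k = rho k.
Proof. by rewrite alpha1E -(rootvecDk R hk). Qed.

Lemma neg_alpha2E : - alpha2 R k = rho (2 * k).-1.
Proof. by rewrite alpha2E -(rootvecDk R hk); congr rootvec; lia. Qed.

Lemma croot_of_neg1 : croot_of (neg1 k m) = (- alpha1 R k, 1%N).
Proof. by rewrite neg_alpha1E /croot_of /= /root_index leqnn. Qed.

Lemma croot_of_neg2 : croot_of (neg2 k m) = (- alpha2 R k, 1%N).
Proof. by rewrite neg_alpha2E /croot_of /= /root_index ltnn. Qed.

Lemma colored_rootsP c :
  reflect (exists x, c = croot_of x) (c \in colored_roots R k m).
Proof.
apply: (iffP idP) => [|[x ->]].
  rewrite in_fsetU in_fset2 => /or3P[|/eqP->|/eqP->]; last 2 first.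
  - by exists (neg1 k m); rewrite croot_of_neg1.
  - by exists (neg2 k m); rewrite croot_of_neg2.
  move=> /imfset2P[b /= /pos_rootsP[j jk ->]] [i /=].
  rewrite mem_iota => im ->; exists (decode k m (j, i)).
  rewrite /croot_of (decodeK hk hm) /=; last by rewrite /code_valid /=; lia.
  by rewrite /root_index ltnW.
rewrite in_fsetU in_fset2; case: x => [[j i]|[]]; last 2 first.
- by rewrite croot_of_neg1 eqxx !orbT.
- by rewrite croot_of_neg2 eqxx !orbT.
apply/orP; left; rewrite /croot_of /= /root_index ltnW //.
have jp : rho j \in pos_roots R k by apply/pos_rootsP; exists (nat_of_ord j); rewrite ?ltn_ord.
apply/imfset2P; exists (rho j); first exact: jp.
by exists i.+1; rewrite ?mem_iota ?add1n ?ltnS ?ltn_ord.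
Qed.

(** Modulo 2k, c_+ acts on indices by j -> k - j and c_- by j -> k - 2 - j, which compose to j - 2.
    The exceptions are - alpha_2, held by tau_+ and then sent to alpha_2, and alpha_1, sent to -
    alpha_1 and held there by tau_-. *)
Lemma rot_rootvec j : (j <= k.+1)%N ->
  Defs.rot k (rho (root_index j)) = rho (root_index (if (1 < j)%N then j - 2 else j + k)%N).
Proof.
have inj := rootvec_inj hk; have refl := refl_rootvec R hk.
move=> jk; rewrite /Defs.rot /tau_minus /tau_plus neg_alpha1E neg_alpha2E.
rewrite c_plusE c_minusE /root_index; have [hj|hj] := leqP j k; last first.
  have -> : j = k.+1 by lia.
  rewrite eqxx ifN; last by apply/eqP => /inj; lia.
  rewrite !ifT; [|lia..].
  by rewrite (@refl _ _ (k.+1 - 2) 0 0)%N //; lia.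
have -> : (rho j == rho (2 * k).-1) = false by apply/eqP => /inj; lia.
rewrite (@refl _ _ (k - j) 0 0)%N; last by lia.
have [->|j0] := eqVneq j 0%N; first by rewrite subn0 eqxx /= leqnn.
rewrite ifN; last by apply/eqP => /inj; lia.
have [h1|h1] := ltnP 1 j; first by rewrite ifT ?(@refl _ _ (j - 2) 1 0)%N //; lia.
by rewrite ifF ?(@refl _ _ (2 * k).-1 0 0)%N //; lia.
Qed.

Lemma crot_croot_of x : crot k m (croot_of x) = croot_of (vrot x).
Proof.
have kx := code_le x; rewrite /crot /croot_of /= code_vrot //.
rewrite mem_pos_roots ?root_index_lt // rot_rootvec //.
have -> : (root_index (code x).1 < k)%N = ((code x).1 < k)%N.
  by rewrite /root_index; case: ifP; lia.
by rewrite /code_rot; case: ifP.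
Qed.

Lemma tnth_simple0 : tnth (simple R k) 0 = alpha1 R k. Proof. by []. Qed.
Lemma tnth_simple1 : tnth (simple R k) 1 = alpha2 R k. Proof. by []. Qed.

(** Existence of a compatibility relation, which gives meaning to the choice operator [get] in
    [compatible]. *)
Lemma is_compatibility_adj : is_compatibility k m
  (fun c d : 'cV[R]_2 * nat =>
     [exists x, exists y, [&& c == croot_of x, d == croot_of y & adj x y]]).
Proof.
set r := (fun c d => _).
have rE x y : r (croot_of x) (croot_of y) = adj x y.
  apply/existsP/idP => [[x' /existsP[y' /and3P[]]]|xy].
    by move=> /eqP/croot_of_inj -> /eqP/croot_of_inj ->.
  by exists x; apply/existsP; exists y; rewrite !eqxx.
split.
- move=> c d /existsP[x /existsP[y /and3P[/eqP-> /eqP-> _]]].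
  by split; apply/colored_rootsP; eexists.
- move=> c d; apply/existsP/existsP=> -[x /existsP[y /and3P[cx dy xy]]];
    by exists y; apply/existsP; exists x; rewrite cx dy adj_sym.
- move=> j c /colored_rootsP[y ->]; have [->|->] := ord2P j.
    by rewrite tnth_simple0 -croot_of_neg1 rE adj_neg1 // coord0_eq0 // code_le.
  by rewrite tnth_simple1 -croot_of_neg2 rE adj_neg2 // coord1_eq0 // code_le.
- move=> c d /colored_rootsP[x ->] /colored_rootsP[y ->].
  by rewrite !crot_croot_of !rE (adj_iter_vrot hk hm 1).
Qed.

(** Uniqueness: [x] is an iterate of a negative simple root, rotating back preserves both relations,
    and there the coordinates prescribe the value. *)
Lemma compatible_adj x y : compatible k m (croot_of x) (croot_of y) = adj x y.
Proof.
have [_ rS r0 rI] : is_compatibility k m (@compatible R k m).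
  by rewrite /compatible; apply: getPex; eexists; exact: is_compatibility_adj.
have rIn n u v : compatible k m (croot_of (iter n (@vrot k m) u)) (croot_of (iter n (@vrot k m) v))
    = compatible k m (croot_of u) (croot_of v).
  elim: n => //= n <-; rewrite -!crot_croot_of.
  by apply: rI; apply/colored_rootsP; eexists.
suff H n b : x = iter n (@vrot k m) (inr b) ->
    compatible k m (croot_of x) (croot_of y) = adj x y.
  by have [n] := vertex_reach hk hm x; case: ifP => _; apply: H.
move=> ->; have -> : y = iter n (@vrot k m) (iter (vperiod k m * n - n) (@vrot k m) y).
  by rewrite -iterD subnKC ?leq_pmull ?vperiod_gt0 // mulnC iter_vperiodM.
set z := iter _ _ y; rewrite rIn adj_iter_vrot //.
have zc : croot_of z \in colored_roots R k m by apply/colored_rootsP; exists z.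
case: b; rewrite -/(neg1 k m) -/(neg2 k m).
  by rewrite croot_of_neg1 adj_neg1 // -tnth_simple0 r0 // coord0_eq0 // code_le.
by rewrite croot_of_neg2 adj_neg2 // -tnth_simple1 r0 // coord1_eq0 // code_le.
Qed.

End ColoredRoots.

(** * Absolute order and parabolic subgroups *)

Section ParabolicTypes.
Variables (R : realType) (k : nat).
Hypothesis hk : (2 < k)%N.
Local Open Scope ring_scope.
Local Open Scope classical_set_scope.

Local Notation rho := (rootvec R k).
Local Notation T j := (refl (rho j)).
Local Notation rotm := (rotm R k).
Local Notation roots := (Defs.roots R k).

Lemma rootsP (b : 'cV[R]_2) : b \in roots -> exists j, b = rho j.
Proof. by move=> /imfsetP[j _ ->]; exists j. Qed.

Lemma mem_roots j : rho j \in roots.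
Proof.
apply/imfsetP; exists (j %% (2 * k))%N.
  by rewrite /= mem_iota add0n ltn_pmod //; lia.
apply: (@rootvec_cong R k hk _ _ 0 (j %/ (2 * k))).
by rewrite muln0 addn0 addnC mulnC -divn_eq.
Qed.

Lemma cox_rotm : cox R k = rotm 1. Proof. by []. Qed.
Lemma one_rotm : 1 = rotm 0. Proof. by []. Qed.

Lemma refl_neq1 j : T j <> 1.
Proof. by rewrite one_rotm => E; have := rotm_neq_refl R k 0 j; rewrite E eqxx. Qed.

Lemma det_reflprod (s : seq 'cV[R]_2) : {subset s <= roots} ->
  \det (reflprod s) = (-1) ^+ size s.
Proof.
elim: s => [|b s IH] hs; first by rewrite /reflprod big_nil det1.
have [j ->] := rootsP (hs b (mem_head _ _)).
rewrite /reflprod big_cons -mulmxE det_mulmx det_refl exprS -IH //.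
by move=> c cs; apply: hs; rewrite inE cs orbT.
Qed.

(** A word for [w] ensures that a shortest one exists, so that [get] returns a genuine length. *)
Lemma abs_lengthP (w : 'M[R]_2) (s : seq 'cV[R]_2) : {subset s <= roots} ->
  reflprod s = w -> is_abs_length k w (abs_length k w).
Proof.
move=> hs Es; rewrite /abs_length; apply: getPex.
pose P n := `[< exists2 s : seq 'cV[R]_2, {subset s <= roots} & reflprod s = w /\ size s = n >].
have exP : exists n, P n by exists (size s); apply/asboolP; exists s.
exists (ex_minn exP); case: ex_minnP => n /asboolP Pn min; split => // s' hs' Es'.
by apply: min; apply/asboolP; exists s'.
Qed.

Lemma abs_length_refl j : abs_length k (T j) = 1%N.
Proof.
have hs : {subset [:: rho j] <= roots} by move=> x; rewrite inE => /eqP->; exact: mem_roots.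
have Es : reflprod [:: rho j] = T j by rewrite /reflprod big_seq1.
have [[s hs' [Es' sz]] /(_ _ hs Es) le1] := abs_lengthP hs Es.
apply/eqP; rewrite eqn_leq le1 lt0n -sz /=; apply/eqP => /size0nil s0.
by move: Es'; rewrite s0 /reflprod big_nil => /esym/refl_neq1.
Qed.

Lemma abs_length1 : abs_length k (1 : 'M[R]_2) = 0%N.
Proof.
have hs : {subset [::] <= roots} by [].
have Es : reflprod [::] = 1 :> 'M[R]_2 by rewrite /reflprod big_nil.
have [_ /(_ _ hs Es)] := abs_lengthP hs Es.
by rewrite leqn0 => /eqP.
Qed.

(** Two reflections suffice; length 1 is excluded by the determinant, and length 0 because the
    rotation is not the identity. *)
Lemma abs_length_rotm n : ~~ (k %| n)%N -> abs_length k (rotm n) = 2%N.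
Proof.
move=> kn; have hs : {subset [:: rho n; rho 0] <= roots}.
  by move=> x; rewrite !inE => /orP[]/eqP->; exact: mem_roots.
have Es : reflprod [:: rho n; rho 0] = rotm n.
  rewrite /reflprod big_cons big_seq1.
  by apply: (@refl_mul_refl R k hk _ _ _ 0 0).
have [[s hs' [Es' sz]] /(_ _ hs Es) le2] := abs_lengthP hs Es.
apply/eqP; rewrite eqn_leq le2 /=; move: (det_reflprod hs'); rewrite Es' det_rotm sz.
case E: (abs_length _ _) sz le2 => [|[|l]] //= sz _.
  by move: Es'; rewrite (size0nil sz) /reflprod big_nil => /esym/rotm_eq1; rewrite (negbTE kn) => /(_ hk).
by rewrite expr1 => E'; exfalso; clear -E'; lra.
Qed.

Lemma abs_le1_cox : abs_le k 1 (cox R k).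
Proof.
split; [exact: weyl1|exact: (weyl_rotm R k 1)|].
by rewrite invr1 mul1r abs_length1.
Qed.

Lemma k_ndvd1 : ~~ (k %| 1)%N. Proof. by rewrite dvdn1; lia. Qed.

Lemma abs_le_refl_cox j : abs_le k (T j) (cox R k).
Proof.
split; [exact: weyl_refl|exact: (weyl_rotm R k 1)|].
rewrite refl_inv // cox_rotm abs_length_rotm ?k_ndvd1 // abs_length_refl.
rewrite (@refl_mul_rotm R k hk _ _ (j + k.-1) 1 0)%N; last by lia.
by rewrite abs_length_refl.
Qed.

Lemma abs_le_cox_cox : abs_le k (cox R k) (cox R k).
Proof.
have W := weyl_rotm R k 1; split=> //.
by rewrite mulVr ?(weyl_unit hk) // abs_length1 addn0.
Qed.

(** [rotm k.-1] is the inverse of c and would leave c^2, nontrivial for [k > 2], so the lengths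
    would give 2 = 2 + 2. This rules out the wrong ordering of an edge. *)
Lemma not_abs_le_cox_inv : ~ abs_le k (rotm k.-1) (cox R k).
Proof.
case=> _ _; rewrite rotm_inv // cox_rotm -rotmD.
have -> : rotm (k.-1 * k.-1 + 1) = rotm 2.
  by apply: (@rotm_cong R k hk _ _ 2 k); nia.
by rewrite !abs_length_rotm // ?k_ndvd1 //; apply/negP => /dvdn_leq; lia.
Qed.

Definition refl_subgroup j : set 'M[R]_2 := [set w | w = 1 \/ w = T j].

(** A nonzero fixed vector excludes nontrivial rotations and determines the reflection, since its
    root is orthogonal to that vector. *)
Lemma pstab_line (A : set 'cV[R]_2) j v : A v -> v != 0 ->
  (forall u, A u -> ((rho j)^T *m u) 0 0 = 0) -> pstab k A = refl_subgroup j.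
Proof.
move=> Av v0 orth; apply/seteqP; split=> w.
  move=> [/(weylP hk) ww fixA]; case: ww => -[n En]; rewrite En in fixA *.
    by left; apply: (rotm_fix hk v0); apply: fixA.
  right; apply: (uvec_orth_eq_refl v0); last exact: orth.
  by apply/refl_uvec_fix/fixA.
case=> ->; split; [exact: weyl1| | exact: weyl_refl |].
  by move=> u _; rewrite mul1mx.
by move=> u /orth h; apply/refl_uvec_fix.
Qed.

Lemma pstab_Fix_refl j : pstab k (Fix (T j)) = refl_subgroup j.
Proof.
apply: (@pstab_line _ _ (uvec (j%:R * pi / k%:R + pi / 2))); last 1 first.
- by move=> u; rewrite /Fix /= => /refl_uvec_fix.
- apply/refl_uvec_fix; rewrite uvec_dot -[RHS](cos_pihalf R) -[RHS]cosN.
  by congr cos; ring.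
- exact: uvec_neq0.
Qed.

Lemma pstab_Fix_cox : pstab k (Fix (cox R k)) = weyl k.
Proof.
apply/seteqP; split=> [w []//|w ww]; split=> // v fv.
have [->|v0] := eqVneq v 0; first by rewrite mulmx0.
have /(rotm_eq1 hk) := rotm_fix hk v0 (n := 1) fv.
by rewrite (negbTE k_ndvd1).
Qed.

Lemma pstab_all (A : set 'cV[R]_2) : (forall v, A v) -> pstab k A = [set 1].
Proof.
move=> hA; apply/seteqP; split=> w.
  by case=> _ f; apply: mx2_uvecP => s; rewrite mul1mx f.
by move=> ->; split; [exact: weyl1|move=> v _; rewrite mul1mx].
Qed.

Lemma conj_weyl P : conj_subgroups k (weyl k) P <-> P = @weyl R k.
Proof.
have E (w : 'M[R]_2) : weyl k w -> [set w * p * w^-1 | p in weyl k] = weyl k.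
  move=> ww; apply/seteqP; split=> [_ [p wp <-]|p wp].
    by apply: weylM; [apply: weylM|apply: weylV].
  have uw := weyl_unit hk ww; exists (w^-1 * p * w).
    by apply: weylM => //; apply: weylM => //; apply: weylV.
  by rewrite !mulrA mulrV // mul1r -mulrA mulrV // mulr1.
split=> [[w ww ->]|->]; first exact: E.
by exists 1; [exact: weyl1|rewrite E //; exact: weyl1].
Qed.

Lemma conj_trivial P : conj_subgroups k [set 1 : 'M[R]_2] P <-> P = [set 1].
Proof.
have E (w : 'M[R]_2) : weyl k w -> [set w * p * w^-1 | p in [set 1]] = [set 1].
  by move=> ww; rewrite image_set1 mulr1 mulrV // (weyl_unit hk).
split=> [[w ww ->]|->]; first exact: E.
by exists 1; [exact: weyl1|rewrite E //; exact: weyl1].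
Qed.

Lemma rotm_conj_refl n i : rotm n * T i * (rotm n)^-1 = T (i + n.*2).
Proof.
rewrite rotm_inv // rotm_mul_refl //.
by apply: (@refl_mul_rotm R k hk _ _ _ n 0); nia.
Qed.

Lemma refl_conj_refl n i : T n * T i * (T n)^-1 = T (i * k.-1 + n.*2).
Proof.
rewrite refl_inv // (@refl_mul_refl R k hk _ _ (n + i * k.-1) i 0)%N; last by nia.
by rewrite rotm_mul_refl //; congr (refl (rootvec _ _ _)); lia.
Qed.

(** Conjugation by a rotation shifts the index by an even number, and by a reflection negates it up
    to an even number. Parity is thus invariant for even [k], while adding an odd [k] changes it. *)
Lemma conj_refl_subgroup i j :
  conj_subgroups k (refl_subgroup i) (refl_subgroup j) <->
  odd k || (odd i == odd j).
Proof.
split=> [[w ww E]|h].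
  have [ok|ek] := boolP (odd k) => //=.
  have modk2 a b : a = b %[mod k] -> odd a = odd b.
    move=> E'; rewrite (divn_eq a k) (divn_eq b k) E' !oddD !oddM.
    by rewrite (negbTE ek) !andbF.
  have : refl_subgroup j (T j) by right.
  rewrite E => -[p [->|->]].
    by rewrite mulr1 mulrV ?(weyl_unit hk) // => /esym/refl_neq1.
  have [[n ->]|[n ->]] := weylP hk ww.
    rewrite rotm_conj_refl => /(refl_eq hk)/modk2.
    by rewrite oddD odd_double addbF => ->.
  rewrite refl_conj_refl => /(refl_eq hk)/modk2 <-.
  by rewrite oddD odd_double addbF oddM; apply/eqP; lia.
have [n En] : exists n, T (i + n.*2) = T j.
  (* [e] makes the sum even, so it can be halved; then [i + n.*2] equals [j + k * (i + e)]. *)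
  have [e Ee] : exists e, ~~ odd (j + k.-1 * i + e * k).
    exists (odd (j + k.-1 * i) : nat); move: h; rewrite !oddD !oddM.
    by case: (odd j) (odd i) => -[]; lia.
  exists (j + k.-1 * i + e * k)./2.
  have := odd_double_half (j + k.-1 * i + e * k); rewrite (negbTE Ee) add0n => ->.
  by apply: (@refl_cong R k hk _ _ 0 (i + e)); nia.
exists (rotm n); first exact: weyl_rotm.
have un := weyl_unit hk (weyl_rotm R k n).
apply/seteqP; split=> w.
  case=> ->; [exists 1|exists (T i)]; [by left| |by right|].
    by rewrite mulr1 mulrV.
  by rewrite rotm_conj_refl.
case=> p [->|->] <-; first by left; rewrite mulr1 mulrV.
by right; rewrite rotm_conj_refl.
Qed.

Lemma weyl_neq1 : @weyl R k <> [set 1].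
Proof.
move=> E; have : weyl k (T 0) by exact: weyl_refl.
by rewrite E => /refl_neq1.
Qed.

Lemma weyl_neq_refl_subgroup j : weyl k <> refl_subgroup j.
Proof.
move=> E; have := weyl_rotm R k 1; rewrite E => -[/(rotm_eq1 hk)|e].
  by rewrite (negbTE k_ndvd1).
by have := rotm_neq_refl R k 1 j; rewrite e eqxx.
Qed.

Lemma refl_subgroup_neq1 j : refl_subgroup j <> [set 1].
Proof.
move=> E; have : refl_subgroup j (T j) by right.
by rewrite E => /refl_neq1.
Qed.

Lemma conj_refl_subgroupE i P : conj_subgroups k (refl_subgroup i) P ->
  exists j, P = refl_subgroup j.
Proof.
case=> w ww ->; have uw := weyl_unit hk ww.
have [j Ej] : exists j, w * T i * w^-1 = T j.
  have [[n ->]|[n ->]] := weylP hk ww; first by rewrite rotm_conj_refl; eexists.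
  by rewrite refl_conj_refl; eexists.
exists j; apply/seteqP; split=> [_ [p [->|->] <-]|_ [->|->]].
- by left; rewrite mulr1 mulrV.
- by right.
- by exists 1; [left|rewrite mulr1 mulrV].
- by exists (T i); [right|].
Qed.

Lemma hyperplaneP (b v : 'cV[R]_2) : (v \in hyperplane b) = ((b^T *m v) 0 0 == 0).
Proof.
rewrite memv_ker lfunE /=; apply/eqP/eqP => [->|E]; first by rewrite mxE.
by rewrite [LHS]mx11_scalar E; apply/matrixP => i j; rewrite !mxE mul0rn.
Qed.

Lemma parabolic_flat (X : {vspace 'cV[R]_2}) : flat k X ->
  [\/ rk X = 2%N /\ parabolic k X = weyl k,
      rk X = 1%N /\ exists j, parabolic k X = refl_subgroup j |
      rk X = 0%N /\ parabolic k X = [set 1]].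
Proof.
move=> [s hs EX]; have dimle : (\dim X <= 2)%N.
  by have := dimvS (subvf X); rewrite dimvf dim_matrix.
rewrite /rk; case E: (\dim X) dimle => [|[|[|//]]] _.
- apply: Or31; split=> //; apply/seteqP; split=> [w []//|w ww]; split=> // v /=.
  by have /eqP := E; rewrite dimv_eq0 => /eqP->; rewrite memv0 => /eqP->; rewrite mulmx0.
- apply: Or32; split=> //.
  have X0 : vpick X != 0 by rewrite vpick0 -dimv_eq0 E.
  (* The empty intersection has dimension 2, so a line is contained in some root hyperplane. *)
  case: s hs EX => [|b s] hs EX.
    by move: E; rewrite EX big_nil dimvf dim_matrix.
  have [j Ej] := rootsP (hs b (mem_head _ _)).
  exists j; apply: (@pstab_line _ j (vpick X)) => //=; first exact: memv_pick.
  move=> u; rewrite EX big_cons memv_cap => /andP[]; rewrite hyperplaneP Ej.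
  by move=> /eqP.
- apply: Or33; split=> //; apply: pstab_all => v /=.
  have /eqP -> : X == fullv by rewrite eqEdim subvf dimvf dim_matrix E.
  exact: memvf.
Qed.

End ParabolicTypes.

(** * Faces and their types *)

Section Faces.
Variables (R : realType) (k m : nat).
Hypotheses (hk : (2 < k)%N) (hm : (0 < m)%N).
Local Open Scope ring_scope.
Local Open Scope fset_scope.

Local Notation rho := (rootvec R k).
Local Notation T j := (refl (rho j)).
Local Notation rotm := (rotm R k).
Local Notation vertex := (vertex k m).
Local Notation croot_of := (@croot_of R k m).
Local Notation croot := ('cV[R]_2 * nat)%type.
Local Notation idx x := (root_index k (@code k m x).1).

(** * Faces have at most two vertices *)

Lemma mem_cluster_complex (f : {fset croot}) : reflect
  ({subset f <= colored_roots R k m} /\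
   {in f &, forall c d, c != d -> compatible k m c d})
  (f \in cluster_complex R k m).
Proof.
rewrite !inE /= fpowersetE; apply: (iffP andP) => -[].
  move=> /fsubsetP sf /forallP H; split=> // c d cf df cd.
  have := H [` cf]; move=> /forallP/(_ [` df])/implyP; apply.
  by apply: contraNneq cd => -[->].
move=> sf H; split; first exact/fsubsetP.
apply/forallP => c; apply/forallP => d; apply/implyP => cd.
by apply: H; rewrite ?fsvalP //; apply: contraNneq cd => /val_inj ->.
Qed.

Lemma cluster_complexP (f : {fset croot}) : f \in cluster_complex R k m <->
  [\/ f = fset0, exists x, f = [fset croot_of x] |
      exists x y, arrow x y /\ f = [fset croot_of x; croot_of y]].
Proof.
split=> [/mem_cluster_complex[sf cf]|].
  have [->|[c cf0]] := fset_0Vmem f; first exact: Or31.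
  have /(colored_rootsP hk hm)[x Ex] := sf _ cf0.
  have [f0|[d]] := fset_0Vmem (f `\ c).
    apply: Or32; exists x; rewrite -Ex; apply/fsetP => d.
    rewrite in_fset1; apply/idP/eqP => [df|->//]; apply: contraTeq df => dc.
    by apply/negP => df; have : d \in f `\ c by [rewrite in_fsetD1 dc]; rewrite f0 in_fset0.
  rewrite in_fsetD1 => /andP[dc df]; have /(colored_rootsP hk hm)[y Ey] := sf _ df.
  have xy : adj x y by rewrite -(@compatible_adj R) // -Ex -Ey cf // eq_sym.
  (* A third vertex would form a triangle of adjacent vertices. *)
  have ff : f = [fset c; d].
    apply/fsetP => e; rewrite in_fset2; apply/idP/idP => [ef|/orP[]/eqP->//].
    have /(colored_rootsP hk hm)[z Ez] := sf _ ef.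
    have [//|ec] := eqVneq e c; have [//|ed] := eqVneq e d.
    have xz : adj x z by rewrite -(@compatible_adj R) // -Ex -Ez cf // eq_sym.
    have yz : adj y z by rewrite -(@compatible_adj R) // -Ey -Ez cf // eq_sym.
    by have := adj_triangle hk hm xy yz; rewrite xz.
  apply: Or33; case/orP: xy => xy; first by exists x, y; rewrite ff Ex Ey.
  by exists y, x; rewrite ff Ex Ey fsetUC.
case=> [->|[x ->]|[x [y [xy ->]]]]; apply/mem_cluster_complex; split.
- by move=> c; rewrite in_fset0.
- by move=> c d; rewrite in_fset0.
- by move=> c; rewrite in_fset1 => /eqP->; apply/(colored_rootsP hk hm); exists x.
- by move=> c d; rewrite !in_fset1 => /eqP-> /eqP->; rewrite eqxx.
- by move=> c; rewrite in_fset2 => /orP[]/eqP->; apply/(colored_rootsP hk hm); eexists.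
- by move=> c d; rewrite !in_fset2 => /orP[]/eqP-> /orP[]/eqP->; rewrite ?eqxx // => _;
    rewrite compatible_adj // /adj /code_adj -!/(arrow _ _) xy ?orbT.
Qed.

Lemma perm_eq_fset1 (A : choiceType) (s : seq A) (a : A) :
  perm_eq s [fset a] <-> s = [:: a].
Proof.
split=> [ps|->]; last by apply: uniq_perm; rewrite ?fset_uniq // => b; rewrite !inE.
have := perm_size ps; rewrite -/(#|` [fset a]|) cardfs1.
have := perm_mem ps; case: s {ps} => [|u [|//]] //= ms _.
by have := ms u; rewrite !inE eqxx => /esym/eqP->.
Qed.

Lemma perm_eq_fset2 (A : choiceType) (s : seq A) (a b : A) : a != b ->
  perm_eq s [fset a; b] -> s = [:: a; b] \/ s = [:: b; a].
Proof.
move=> ab ps; have us : uniq s by rewrite (perm_uniq ps) fset_uniq.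
have := perm_size ps; rewrite -/(#|` [fset a; b]|) cardfs2 ab.
have ms : s =i [fset a; b] by exact: perm_mem.
case: s us ms {ps} => [|u [|v [|//]]] //=; rewrite inE andbT => uv ms _.
have := ms u; have := ms v; rewrite !inE !eqxx orbT /=.
move=> /esym/orP[]/eqP Ev /esym/orP[]/eqP Eu; move: uv; rewrite Eu Ev ?eqxx //; tauto.
Qed.

(** * Parabolic types of the empty face, vertices and edges *)

Lemma face_type0 P : has_parabolic_type k (fset0 : {fset croot}) P <-> P = weyl k.
Proof.
have E : c_plus R k * reflprod [::] * c_minus R k = cox R k.
  by rewrite /reflprod big_nil mulr1.
split=> [[s [ps _]]|->].
  have -> : s = [::] by apply/nilP; rewrite /nilp (perm_size ps) -/(#|` fset0|) cardfs0.
  by rewrite /= E pstab_Fix_cox // conj_weyl.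
exists [::]; split; rewrite ?perm_refl //=.
  by rewrite /reflprod big_nil; exact: abs_le1_cox.
by rewrite E pstab_Fix_cox // conj_weyl.
Qed.

(** The index [(idx x).+1 * k.-1] is - idx x - 1 modulo [k], the index of the reflection c_+ t
    c_-. *)
Lemma face_type1 x P : has_parabolic_type k [fset croot_of x] P <->
  conj_subgroups k (@refl_subgroup R k ((idx x).+1 * k.-1)) P.
Proof.
have E : c_plus R k * reflprod (unzip1 [:: croot_of x]) * c_minus R k
    = T ((idx x).+1 * k.-1)%N.
  rewrite /reflprod big_seq1 c_plusE c_minusE -mulrA /=.
  rewrite (@refl_mul_refl R k hk _ _ (idx x).+1 1 0)%N; last by lia.
  by apply: (@refl_mul_rotm R k hk _ _ _ (idx x).+1 0); nia.
split=> [[s [ps _]]|].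
  by move/perm_eq_fset1: ps => ->; rewrite E pstab_Fix_refl.
rewrite -pstab_Fix_refl // -E => H; exists [:: croot_of x]; split=> //.
  exact/perm_eq_fset1.
by rewrite /reflprod big_seq1; exact: abs_le_refl_cox.
Qed.

Lemma arrow_index (x y : vertex) : arrow x y -> exists p q, (idx y + k * p = (idx x).+1 + k * q)%N.
Proof.
have := code_validP hk hm x; have := code_validP hk hm y.
rewrite /arrow /code_valid /root_index.
case: (code x) (code y) => [j i] [j' i'] /= Vy Vx /or4P[] /= h.
- by exists 0%N, 0%N; rewrite !ifT; lia.
- case/andP: h => /eqP-> /orP[]/eqP->; last by exists 1%N, 0%N; rewrite ltnn leqnn; lia.
  by exists 2%N, 0%N; rewrite ltnn leq0n; lia.
- by exists 0%N, 0%N; rewrite !ifT; lia.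
- by exists 1%N, 0%N; rewrite !ifT; lia.
Qed.

(** Of the two orderings only t_y t_x = c lies below c, the other product being the inverse of c.
    Then c_+ c c_- = 1 fixes the whole plane. *)
Lemma face_type2 x y P : arrow x y ->
  has_parabolic_type k [fset croot_of x; croot_of y] P <-> P = [set 1]%classic.
Proof.
move=> xy; have [p [q Epq]] := arrow_index xy.
have Tyx : T (idx y) * T (idx x) = cox R k.
  by rewrite cox_rotm; apply: (@refl_mul_refl R k hk _ _ _ p q); rewrite addn1.
have Txy : T (idx x) * T (idx y) = rotm k.-1.
  by apply: (@refl_mul_refl R k hk _ _ _ q.+1 p); lia.
have nxy : croot_of x != croot_of y.
  apply/eqP => /(croot_of_inj hk hm) E; have := adj_irrefl hk hm x.
  by rewrite {2}E /adj /code_adj -/(arrow x y) xy.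
have E1 : reflprod (unzip1 [:: croot_of y; croot_of x]) = cox R k.
  by rewrite /reflprod big_cons big_seq1.
have E : pstab k (Fix (c_plus R k * cox R k * c_minus R k)) = [set 1]%classic.
  apply: pstab_all => v.
  by rewrite /cox c_plusE c_minusE mulrA reflK mul1r reflK /Fix /= mul1mx.
split=> [[s [ps ale]]|->].
  have [Es|Es] := perm_eq_fset2 nxy ps; rewrite Es in ale *.
    by move: ale; rewrite /reflprod big_cons big_seq1 /= Txy => /not_abs_le_cox_inv.
  by rewrite E1 E conj_trivial.
exists [:: croot_of y; croot_of x]; split.
- apply: uniq_perm; rewrite ?fset_uniq //= ?inE ?andbT 1?eq_sym // => c.
  by rewrite !inE orbC.
- by rewrite E1; exact: abs_le_cox_cox.
- by rewrite E1 E conj_trivial.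
Qed.

Lemma faces_of_typeP (f : {fset croot}) P : f \in @faces_of_type R k m P <->
  [\/ f = fset0 /\ P = weyl k,
      exists x, f = [fset croot_of x] /\
        conj_subgroups k (@refl_subgroup R k ((idx x).+1 * k.-1)) P |
      exists x y, [/\ arrow x y, f = [fset croot_of x; croot_of y] & P = [set 1]%classic]].
Proof.
have -> : (f \in @faces_of_type R k m P) =
    (f \in cluster_complex R k m) && `[< has_parabolic_type k f P >] by rewrite !inE.
split=> [/andP[/cluster_complexP fC /asboolP fP]|H].
  case: fC fP => [->|[x ->]|[x [y [xy ->]]]].
  - by move=> /face_type0; constructor.
  - by move=> /face_type1 fP; apply: Or32; exists x.
  - by move=> /(face_type2 _ xy) fP; apply: Or33; exists x, y.
case: H => [[-> ->]|[x [-> fP]]|[x [y [xy -> ->]]]]; apply/andP; split.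
- by apply/cluster_complexP; constructor.
- exact/asboolP/face_type0.
- by apply/cluster_complexP; apply: Or32; exists x.
- exact/asboolP/face_type1.
- by apply/cluster_complexP; apply: Or33; exists x, y.
- by apply/asboolP; apply/(face_type2 _ xy).
Qed.

Lemma faces_of_type_weyl f : f \in @faces_of_type R k m (weyl k) <-> f = fset0.
Proof.
rewrite faces_of_typeP; split=> [|->]; last by constructor.
case=> [[]//|[x [_ /(conj_refl_subgroupE hk)[j /(weyl_neq_refl_subgroup hk)]]]//|].
by move=> [x [y [_ _ /(weyl_neq1 hk)]]].
Qed.

Lemma faces_of_type_trivial f : f \in @faces_of_type R k m [set 1]%classic <->
  exists x y, arrow x y /\ f = [fset croot_of x; croot_of y].
Proof.
rewrite faces_of_typeP; split=> [|[x [y [xy ->]]]]; last by apply: Or33; exists x, y.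
case=> [[_ /esym/(weyl_neq1 hk)]//|[x [_ /(conj_refl_subgroupE hk)[j]]]|].
  by move=> /esym/refl_subgroup_neq1.
by move=> [x [y [xy -> _]]]; exists x, y.
Qed.

(** For even [k], passing from j to - j - 1 flips the parity, hence the inequality. *)
Definition vertex_class j : pred vertex :=
  fun x => odd k || (odd (code x).1 != odd j).

Lemma faces_of_type_refl j f : f \in @faces_of_type R k m (@refl_subgroup R k j) <->
  exists2 x, vertex_class j x & f = [fset croot_of x].
Proof.
have Hx x : conj_subgroups k (@refl_subgroup R k ((idx x).+1 * k.-1)) (@refl_subgroup R k j) <->
    vertex_class j x.
  rewrite conj_refl_subgroup // /vertex_class; case: (boolP (odd k)) => //= ek.
  have -> : odd ((idx x).+1 * k.-1) = ~~ odd (code x).1.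
    rewrite oddM /= /root_index; have := code_le hk hm x; case: ifP; lia.
  by case: (odd _) (odd j) => -[].
rewrite faces_of_typeP; split=> [|[x jx ->]]; last by apply: Or32; exists x; rewrite Hx.
case=> [[_ /esym/(weyl_neq_refl_subgroup hk)]//|[x [-> /Hx jx]]|]; first by exists x.
by move=> [x [y [_ _ /refl_subgroup_neq1]]].
Qed.

End Faces.

(** * Values of q-integers at roots of unity *)

Section RootsOfUnity.
Variable R : realType.
Local Open Scope ring_scope.

Lemma expiX (t : R) n : expi t ^+ n = expi (n%:R * t).
Proof.
elim: n => [|n IH]; first by rewrite expr0 mul0r /expi cos0 sin0.
rewrite exprS IH -natr1 mulrDl mul1r addrC /expi cosD sinD.
by apply/eqP; rewrite eq_complex /=; apply/andP; split; apply/eqP; ring.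
Qed.

Lemma expi_primitive d : (0 < d)%N -> d.-primitive_root (expi (2 * pi / d%:R : R)).
Proof.
move=> d0; have dR : d%:R != 0 :> R by rewrite pnatr_eq0 -lt0n.
rewrite /primitive_root_of_unity d0; apply/forallP => i; apply/eqP.
rewrite unity_rootE expiX; have [->|id] := eqVneq i.+1 d.
  have -> : d%:R * (2 * pi / d%:R) = pi *+ 2 :> R by field.
  by rewrite /expi cos2pi sin2pi eqxx.
apply/negbTE/eqP => -[] /cos_eq1 H _; have p0 := pi_gt0 R.
have ltid : (i.+1 < d)%N by rewrite ltn_neqAle id ltn_ord.
have /H/eqP : 0 <= i.+1%:R * (2 * pi / d%:R : R) < pi *+ 2.
  have d0R : 0 < d%:R :> R by rewrite ltr0n.
  rewrite mulr_ge0 ?ler0n ?divr_ge0 ?mulr_ge0 ?ler0n ?(ltW p0) //=.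
  rewrite mulrA ltr_pdivrMr // -[pi *+ 2]mulr_natl mulrC ltr_pM2l ?ltr_nat //.
  by rewrite mulr_gt0.
rewrite !mulf_eq0 invr_eq0 (negbTE dR) (gt_eqF p0) !orbF !pnatr_eq0 //.
Qed.

Local Notation ev P z := ((map_poly intr P : {poly R[i]}).[z]).

Lemma ev_geom a b (z : R[i]) : ev (\sum_(i < b) 'X^(a * i)) z = \sum_(i < b) (z ^+ a) ^+ i.
Proof.
rewrite rmorph_sum horner_sum; apply: eq_bigr => i _.
by rewrite /= map_polyXn hornerXn exprM.
Qed.

Lemma ev_qint a (z : R[i]) : ev (qint a) z = \sum_(i < a) z ^+ i.
Proof.
have := ev_geom 1 a z; rewrite expr1 => <-.
by congr (ev _ z); apply: eq_bigr => i _; rewrite mul1n.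
Qed.

Lemma geom_one n : \sum_(i < n) (1 : R[i]) ^+ i = n%:R.
Proof.
rewrite (eq_bigr (fun=> 1)) => [|i _]; last by rewrite expr1n.
by rewrite sumr_const card_ord.
Qed.

Lemma geom_unity n (z : R[i]) : z ^+ n = 1 ->
  \sum_(i < n) z ^+ i = if z == 1 then n%:R else 0.
Proof.
move=> zn; case: eqP => [->|/eqP z1]; first exact: geom_one.
have := subrX1 z n; rewrite zn subrr => /esym/eqP.
by rewrite mulf_eq0 subr_eq0 (negbTE z1) => /eqP.
Qed.

Lemma geom_neq0 n (z : R[i]) : z ^+ n != 1 -> \sum_(i < n) z ^+ i != 0.
Proof. by rewrite -subr_eq0 subrX1 mulf_eq0 => /norP[]. Qed.

Lemma evM P Q (z : R[i]) : ev (P * Q) z = ev P z * ev Q z.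
Proof. by rewrite rmorphM hornerM. Qed.

Section MuValues.
Variables (k m d : nat) (z : R[i]).
Hypotheses (hk : (2 < k)%N) (hm : (0 < m)%N).
Local Notation N := (m * k + 2)%N.
Hypotheses (hz : d.-primitive_root z) (hd : (d %| N)%N).

Let zN : z ^+ N = 1. Proof. by apply/eqP; rewrite -(prim_order_dvd hz). Qed.

Lemma mu_rank1_odd : ev (qint N) z = (if (d %| 1)%N then N else 0)%:R.
Proof.
rewrite ev_qint (geom_unity zN) (prim_order_dvd hz) expr1.
by case: ifP.
Qed.

Lemma mu_rank1_even : ~~ odd k ->
  ev (qint N %/ qint 2) z = (if (d %| 2)%N then N./2 else 0)%:R.
Proof.
move=> ek; have EN : N = (2 * N./2)%N.
  by rewrite mul2n -[LHS]odd_double_half oddD oddM (negbTE ek) andbF.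
have q2 : qint 2 != 0 by rewrite monic_neq0 ?qint_monic.
have -> : qint N %/ qint 2 = \sum_(i < N./2) 'X^(2 * i).
  by apply: (mulIf q2); rewrite mu_rank1_exact // {1}EN qintM mulrC.
rewrite ev_geom geom_unity; last by rewrite -exprM -EN.
by rewrite (prim_order_dvd hz); case: ifP.
Qed.

(** The factor 2 matches the count of ordered pairs in [double_card_fixed_arrows]. *)
Lemma mu_trivial :
  2 * ev ((qint N * qint ((m + 1) * k)) %/ (qint 2 * qint k)) z =
  (if (d %| (if odd k then 1 else 2))%N then N * m.+1
   else if (d %| 2)%N then N else 0)%:R.
Proof.
set P := _ %/ _; have PE : P * (qint 2 * qint k) = qint N * qint ((m + 1) * k).
  by apply: mu_trivial_exact; lia.
have evP : ev P z * ((\sum_(i < 2) z ^+ i) * (\sum_(i < k) z ^+ i)) =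
    (\sum_(i < N) z ^+ i) * (\sum_(i < (m + 1) * k) z ^+ i).
  by rewrite -!ev_qint -!evM PE.
have [d1|d1] := eqVneq d 1%N.
  have z1 : z = 1 by have := prim_expr_order hz; rewrite d1 expr1.
  rewrite d1 dvd1n; move: evP; rewrite z1 !geom_one => evP.
  have k0 : k%:R != 0 :> R[i] by rewrite pnatr_eq0; lia.
  by apply: (mulIf k0); rewrite mulrAC mulrC evP addn1 !natrM mulrA.
have [d2|d2] := boolP (d %| 2)%N; last first.
  have -> : (d %| (if odd k then 1 else 2))%N = false.
    by case: ifP => _; [rewrite dvdn1; apply/negbTE|apply/negbTE].
  have nz1 : \sum_(i < 2) z ^+ i != 0.
    by apply: geom_neq0; rewrite -(prim_order_dvd hz).
  (* If [d] divided [k], then, dividing [N = m * k + 2], it would divide 2. So the denominator does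
     not vanish, while the numerator does. *)
  have nz2 : \sum_(i < k) z ^+ i != 0.
    apply: geom_neq0; rewrite -(prim_order_dvd hz); apply: contra d2 => dk.
    by rewrite -(dvdn_addr 2 (dvdn_mull m dk)).
  have z1 : (z == 1) = false by rewrite -[z]expr1 -(prim_order_dvd hz) dvdn1 (negbTE d1).
  move/eqP: evP; rewrite (geom_unity zN) z1.
  by rewrite mul0r mulf_eq0 mulf_eq0 (negbTE nz1) (negbTE nz2) !orbF => /eqP->; rewrite mulr0.
have dd : d = 2%N.
  by move: (prim_order_gt0 hz) d1 (dvdn_leq (isT : 0 < 2)%N d2); case: d => [|[|[|]]].
have z2 : z ^+ 2 = 1 by have := prim_expr_order hz; rewrite dd.
have z1 : z != 1 by rewrite -[z]expr1 -(prim_order_dvd hz) dd.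
have eN : ~~ odd N by move: hd; rewrite dd dvdn2.
have EN : N = (2 * N./2)%N by rewrite mul2n -[LHS]odd_double_half (negbTE eN).
(* At z = -1 the factor [qint 2] vanishes, so the division is performed on polynomials; it splits
   because [N] is even. *)
have -> : P = (\sum_(i < N./2) 'X^(2 * i)) * (\sum_(i < m + 1) 'X^(k * i)).
  have qk : qint k != 0 by rewrite -(ltn_predK hk) monic_neq0 ?qint_monic.
  have q2 : qint 2 != 0 by rewrite monic_neq0 ?qint_monic.
  have EqN := qintM 2 N./2; rewrite -EN in EqN.
  have Eqk := qintM k (m + 1); rewrite mulnC in Eqk.
  by apply: (mulIf (mulf_neq0 q2 qk)); rewrite PE EqN Eqk; ring.
rewrite evM !ev_geom z2 geom_one mulrA -natrM -EN dd.
have [ok|ek] := boolP (odd k).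
  have -> : z ^+ k = z.
    by rewrite -[k]odd_double_half ok -mul2n exprD exprM z2 expr1n mulr1.
  have em : odd m = false by move: eN; rewrite oddD oddM ok; case: (odd m).
  (* As [m] is even, the alternating sum has an odd number of terms and equals 1. *)
  have zm : z ^+ (m + 1) = z.
    by rewrite exprD -[m]odd_double_half em -mul2n exprM z2 expr1n mul1r.
  have -> : \sum_(i < m + 1) z ^+ i = 1; last by rewrite mulr1.
  have nz : z - 1 != 0 by rewrite subr_eq0.
  by apply: (mulfI nz); rewrite -subrX1 zm mulr1.
have -> : z ^+ k = 1.
  by rewrite -[k]odd_double_half (negbTE ek) -mul2n exprM z2 expr1n.
by rewrite geom_one -natrM addn1.
Qed.

End MuValues.
End RootsOfUnity.

(** * Cyclic sieving *)

Section Sieving.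
Variables (R : realType) (k m : nat).
Hypotheses (hk : (2 < k)%N) (hm : (0 < m)%N).
Local Open Scope ring_scope.
Local Open Scope fset_scope.

Local Notation N := (m * k + 2)%N.
Local Notation vertex := (vertex k m).
Local Notation vrot := (@vrot k m).
Local Notation croot_of := (@croot_of R k m).
Local Notation croot := ('cV[R]_2 * nat)%type.
Local Notation rotf := (@rotate_face R k m).
Local Notation ev P z := ((map_poly intr P : {poly R[i]}).[z]).

Lemma Zp_order_dvd (g : 'Z_N) j : (#[g]%g %| j)%N = (N %| g * j)%N.
Proof.
have EN : (Zp_trunc N).+2 = N by rewrite Zp_cast //; lia.
by rewrite order_dvdn Zp_expg -val_eqE /=; move: (nat_of_ord g) => a; rewrite EN.
Qed.

(** The order [d] of a group element enters only through divisibility, which reduces sieving to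
    counting the fixed points of [iter n r]. *)
Lemma cyclic_sieving_Zp (T : choiceType) (S : {fset T}) (r : T -> T) (P : {poly int}) :
  (forall f, f \in S -> r f \in S) ->
  (forall f, f \in S -> iter N r f = f) ->
  (forall n d (z : R[i]), d.-primitive_root z ->
     (forall j, (d %| j)%N = (N %| n * j)%N) ->
     ev P z = #|` [fset f in S | iter n r f == f] |%:R) ->
  cyclic_sieving R S [set: 'Z_N]%G (fun g f => iter g r f) P.
Proof.
move=> rS rN count; have EN : (Zp_trunc N).+2 = N by rewrite Zp_cast //; lia.
have rSn n f : f \in S -> iter n r f \in S by move=> fS; elim: n => //= n; apply: rS.
split=> //.
- by apply/cyclicP; exists Zp1; apply: Zp_cycle.
- by move=> g f _; apply: rSn.
- move=> g h f _ _ fS; rewrite -iterD /=.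
  move: (nat_of_ord g) (nat_of_ord h) => {}g {}h; rewrite EN.
  (* Addition in ['Z_N] reduces modulo [N], and the discarded multiple of [N] acts trivially. *)
  have rNq q : iter (q * N) r f = f by elim: q => // q IH; rewrite mulSn iterD IH rN.
  by rewrite [in RHS](divn_eq (g + h) N) (addnC (_ * N)%N) iterD rNq.
- move=> g _; apply: count (Zp_order_dvd g).
  by apply: expi_primitive; apply: order_gt0.
Qed.

Lemma card_fset_image (T : finType) (U : choiceType) (A : pred T) (h : T -> U)
    (S : {fset U}) : {in A &, injective h} ->
  (forall u, u \in S <-> exists2 x, A x & u = h x) -> #|` S| = #|A|.
Proof.
move=> hi SP; have -> : S = [fset h x | x in A].
  by apply/fsetP => u; apply/idP/imfsetP => [/SP|]; [|move=> ?; apply/SP].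
by rewrite card_in_imfset //= -cardE.
Qed.

Lemma fset2_eq (A : choiceType) (a b c d : A) :
  ([fset a; b] == [fset c; d]) = (a == c) && (b == d) || (a == d) && (b == c).
Proof.
apply/eqP/idP => [E|/orP[]/andP[/eqP-> /eqP->]//]; last by rewrite fsetUC.
have ha : a \in [fset c; d] by rewrite -E !inE eqxx.
have hb : b \in [fset c; d] by rewrite -E !inE eqxx orbT.
have hc : c \in [fset a; b] by rewrite E !inE eqxx.
have hd : d \in [fset a; b] by rewrite E !inE eqxx orbT.
move: ha hb hc hd; rewrite !inE ![c == _]eq_sym ![d == _]eq_sym.
by do 4!case: eqP.
Qed.

Lemma rotate_face1 n x : iter n rotf [fset croot_of x] = [fset croot_of (iter n vrot x)].
Proof. by elim: n => //= n ->; rewrite /rotate_face imfset_fset1 crot_croot_of. Qed.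

Lemma rotate_face2 n x y : iter n rotf [fset croot_of x; croot_of y] =
  [fset croot_of (iter n vrot x); croot_of (iter n vrot y)].
Proof. by elim: n => //= n ->; rewrite /rotate_face imfset_fset2 !crot_croot_of. Qed.

Lemma sieving_empty : cyclic_sieving R (@faces_of_type R k m (weyl k))
  [set: 'Z_N]%G (fun g f => iter g rotf f) 1.
Proof.
have rot0 : rotf fset0 = fset0 by rewrite /rotate_face imfset0.
have rot0n n : iter n rotf fset0 = fset0 by elim: n => //= n ->.
have S0 := @faces_of_type_weyl R k m hk hm.
apply: cyclic_sieving_Zp => [f /S0 ->|f /S0 ->|n d z _ _].
- by rewrite rot0 S0.
- exact: rot0n.
rewrite rmorph1 hornerC (_ : [fset f in _ | _] = [fset fset0]) ?cardfs1 //.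
apply/fsetP => f; rewrite in_fset1; apply/idP/eqP => [|->].
  by rewrite in_fset inE => /andP[/S0].
by rewrite in_fset inE rot0n eqxx andbT; apply/S0.
Qed.

Lemma vperiod_dvd n d : (forall j, (d %| j) = (N %| n * j))%N ->
  (vperiod k m %| n)%N = (d %| (if odd k then 1 else 2))%N.
Proof.
move=> hd; rewrite hd; case: ifPn => [ok|ek]; first by rewrite muln1 /vperiod ok.
by rewrite (N_even m ek) -muln2 dvdn_pmul2r.
Qed.

(** All vertices have the same period, so a rotation fixes the whole class or none of it. The class
    has [N] elements for odd [k]; for even [k] it is one parity class, with [N / 2]. *)
Lemma sieving_vertex j : cyclic_sieving R (@faces_of_type R k m (@refl_subgroup R k j))
  [set: 'Z_N]%G (fun g f => iter g rotf f)
  (if ~~ odd k then qint N %/ qint 2 else qint N).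
Proof.
have Sj := @faces_of_type_refl R k m hk hm j.
apply: cyclic_sieving_Zp => [f /Sj[x xj ->]|f /Sj[x _ ->]|n d z hz hd].
- rewrite -[rotf _]/(iter 1 rotf _) rotate_face1; apply/Sj; exists (vrot x) => //.
  move: xj; rewrite /vertex_class; have [//|ek] := boolP (odd k).
  by rewrite odd_code_vrot.
- by rewrite rotate_face1 iter_vrot_N.
have dN : (d %| N)%N by rewrite hd dvdn_mull.
pose A : pred vertex := fun x => vertex_class j x && (vperiod k m %| n)%N.
rewrite (@card_fset_image _ _ A (fun x => [fset croot_of x])); last first.
- move=> f; rewrite in_fset inE; split=> [/andP[/Sj[x xj ->]]|[x /andP[xj vn] ->]].
    rewrite rotate_face1 => /eqP/fset1_inj/(croot_of_inj hk hm)/eqP.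
    by rewrite iter_vrot_fix // => vn; exists x => //; apply/andP.
  apply/andP; split; first by apply/Sj; exists x.
  by rewrite rotate_face1; move: vn; rewrite -(iter_vrot_fix hk hm n x) => /eqP->.
- by move=> x y _ _ /fset1_inj/(croot_of_inj hk hm).
have -> : #|A| = (if (vperiod k m %| n)%N then #|@vertex_class k m j| else 0%N).
  rewrite /A; case: ifP => _; last by apply: eq_card0 => x; rewrite unfold_in andbF.
  by apply: eq_card => x; rewrite unfold_in andbT.
rewrite (vperiod_dvd hd); have [ok|ek] := boolP (odd k) => /=.
  rewrite (mu_rank1_odd hz dN); congr (if _ then _ else _)%:R.
  by rewrite -(card_vertex k m); apply: eq_card => x; rewrite [RHS]unfold_in ok.
rewrite (mu_rank1_even hz dN ek) (N_even m ek) doubleK; congr (if _ then _ else _)%:R.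
rewrite -(card_parity_class hk hm (~~ odd j) ek); apply: eq_card => x.
by rewrite [RHS]unfold_in inE (negbTE ek) /=; case: (odd _) (odd j) => -[].
Qed.

Lemma sieving_edge : cyclic_sieving R (@faces_of_type R k m [set 1]%classic)
  [set: 'Z_N]%G (fun g f => iter g rotf f)
  ((qint N * qint ((m + 1) * k)) %/ (qint 2 * qint k)).
Proof.
have S1 := @faces_of_type_trivial R k m hk hm.
apply: cyclic_sieving_Zp => [f /S1[x [y [xy ->]]]|f /S1[x [y [xy ->]]]|n d z hz hd].
- rewrite -[rotf _]/(iter 1 rotf _) rotate_face2; apply/S1.
  have : adj (vrot x) (vrot y) by rewrite (adj_iter_vrot hk hm 1) /adj /code_adj -/(arrow x y) xy.
  (* Rotation may reverse the arrow, so the ends are listed in the other order if necessary. *)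
  by case/orP => ?; [exists (vrot x), (vrot y)|exists (vrot y), (vrot x); rewrite fsetUC].
- by rewrite rotate_face2 !iter_vrot_N.
have dN : (d %| N)%N by rewrite hd dvdn_mull.
have n2 : 2 != 0 :> R[i] by rewrite pnatr_eq0.
apply: (mulfI n2); rewrite (mu_trivial hk hm hz dN) -natrM mul2n.
have fixE x y : (iter n rotf [fset croot_of x; croot_of y] ==
    [fset croot_of x; croot_of y]) = pair_fixed n (x, y).
  by rewrite rotate_face2 fset2_eq !(inj_eq (@croot_of_inj R k m hk hm)).
pose A : pred (vertex * vertex) := fun p => arrow p.1 p.2 && pair_fixed n p.
rewrite (@card_fset_image _ _ A (fun p => [fset croot_of p.1; croot_of p.2])); last first.
- move=> f; rewrite in_fset inE; split=> [/andP[/S1[x [y [xy ->]]]]|[[x y] /andP[xy pf] ->]].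
    by rewrite fixE => pf; exists (x, y) => //; apply/andP.
  by apply/andP; rewrite fixE; split=> //; apply/S1; exists x, y.
(* An edge determines its ordered pair, since its two orientations cannot both be arrows. *)
- move=> [x y] [x' y'] /andP[/= xy _] /andP[/= xy' _] /eqP; rewrite fset2_eq.
  rewrite !(inj_eq (@croot_of_inj R k m hk hm)) => /orP[]/andP[/eqP Ex /eqP Ey].
    by rewrite Ex Ey.
  by have := arrow_asym hk hm xy'; rewrite -Ex -Ey xy.
have -> : #|A| = #|[pred p : vertex * vertex | arrow p.1 p.2 & pair_fixed n p]|.
  exact: eq_card.
(* Instantiating [hd] at 2 turns [d %| 2] into [N %| n * 2], so the two case distinctions
   coincide. *)
rewrite double_card_fixed_arrows // (vperiod_dvd hd) (hd 2) muln2.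
by [].
Qed.

End Sieving.

Local Open Scope ring_scope.

Theorem theorem7p6 (R : realType) (k m : nat) (X : {vspace 'cV[R]_2})
    (hk : (3 <= k)%N) (hm : (1 <= m)%N) (hX : flat k X) :
  cyclic_sieving R (faces_of_type k m (parabolic k X))
    [set: 'Z_(m * k + 2)]%G
    (fun g f => iter g (@rotate_face R k m) f)
    (mu k m X).
Proof.
(* The dimension of [X] selects the branch of [mu]; in ranks 1 and 0 the parabolic subgroup has to
   be told apart from [weyl]. *)
rewrite /mu; have [[-> ->]|[-> [j ->]]|[-> ->]] := parabolic_flat hk hX.
- by rewrite asboolT //; apply: sieving_empty.
- rewrite asboolF; last by move=> /esym/(weyl_neq_refl_subgroup hk).
  exact: sieving_vertex.
- rewrite asboolF; last by move=> /esym/(weyl_neq1 hk).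
  exact: sieving_edge.
Qed.
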